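(* Let $(M,\theta)$ be a pair such that $\dim M\le 2$, $\mathrm H^2(M_0/\theta,\mathbb Z)\cong 0$, $M_0=M\setminus M_\theta$ is dense in $M$, and $\mathrm H^2(\chi(M_0/\theta),\mathbb Z)\cong 0$. Then $C(M)\times_\theta\mathbb Z_p$ is $*$-isomorphic to $$\mathcal A(M_\theta)=\{(a_{ij})_{p\times p}\in \mathrm M_p(C(M/\theta))\mid a_{ij}(x)=0 \text{ for all } x\in M_\theta,\ i\neq j\}.$$
   Context: Throughout, $p$ is a fixed prime number. A pair $(M,\theta)$ consists of a separable compact Hausdorff space $M$ and a homeomorphism $\theta\colon M\to M$ of period $p$ (that is, $\theta^p=\mathrm{id}$ and $\theta\neq\mathrm{id}$) such that the fixed point set $M_\theta=\{x\in M\mid \theta(x)=x\}$ is non-empty. Put $M_0=M\setminus M_\theta$. $M/\theta$ and $M_0/\theta$ denote the orbit spaces of $\theta$ with the quotient topology; $M_0/\theta$ is regarded as an open subspace of $M/\theta$, and $M_\theta$ is identified with its image in $M/\theta$, a closed subset. The homeomorphism $\theta$ acts on $C(M)$ by $\theta(f)(x)=f(\theta(x))$, which gives an action of $\mathbb Z_p=\mathbb Z/p\mathbb Z$, and $C(M)\times_\theta\mathbb Z_p$ is the corresponding crossed product $C^*$-algebra. $\mathrm M_p(\cdot)$ denotes $p\times p$ matrices. $\dim$ is covering dimension. For a locally compact Hausdorff space $X$, $X^+$ is its one-point compactification, $\beta(X)$ its Stone–Čech compactification, and $\chi(X)=\beta(X)\setminus X$ its corona set. $\mathrm H^2(\cdot,\mathbb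 Z)$ is Čech cohomology, with the convention that $\mathrm H^2(X,\mathbb Z)=\mathrm H^2(X^+,\mathbb Z)$ for locally compact Hausdorff $X$ (so $\mathrm H^2(M_0/\theta,\mathbb Z)$ means $\mathrm H^2((M_0/\theta)^+,\mathbb Z)$).
   Formalization: ''Separable'' is taken to mean second countable (equivalently, C(M) is separable); if M is only assumed to have a countable dense subset, the claim fails, for example for p = 2 and the one-point compactification of a suitable double cover of a Mrówka Psi-space. *)

(* Defs.v *)
From HB Require Import structures.
From mathcomp Require Import all_boot all_order all_algebra.
From mathcomp Require Import generic_quotient ring_quotient.
From mathcomp Require Import complex.
From mathcomp Require Import all_classical all_reals all_analysis.

Set Implicit Arguments.
Unset Strict Implicit.
Unset Printing Implicit Defensive.

Import Order.TTheory GRing.Theory Num.Theory.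
Import numFieldTopology.Exports numFieldNormedType.Exports.

Local Open Scope classical_set_scope.
Local Open Scope ring_scope.
Local Open Scope quotient_scope.

(* Packing R[i] as a numClosedFieldType gives it the library's norm topology
   on numeric fields, and Num.conj as complex conjugation. *)
Definition Cplx (R : realType) : numClosedFieldType := R[i]%C.

(** * The *-algebra C(X) *)

Section ContFun.
Variables (R : realType) (X : topologicalType).
Local Notation C := (Cplx R).

Definition contfun_pred : {pred X -> C} := fun f => `[< continuous f >].

Lemma contfun_submod : submod_closed contfun_pred.
Proof.
split; first by apply/asboolP => x; exact: cvg_cst.
move=> k f g /asboolP cf /asboolP cg; apply/asboolP => x.
suff: {for x, continuous (cst k \* f \+ g)} by [].
by apply: continuousD; [apply: continuousM; [exact: cst_continuous|exact: cf]
                       |exact: cg].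
Qed.

Lemma contfun_subring : subring_closed contfun_pred.
Proof.
split; first by apply/asboolP => x; exact: cvg_cst.
  move=> f g /asboolP cf /asboolP cg; apply/asboolP => x.
  suff: {for x, continuous (f \- g)} by [].
  by apply: continuousB; [exact: cf|exact: cg].
move=> f g /asboolP cf /asboolP cg; apply/asboolP => x.
suff: {for x, continuous (f \* g)} by [].
by apply: continuousM; [exact: cf|exact: cg].
Qed.

HB.instance Definition _ :=
  GRing.isSubringClosed.Build (X -> C) contfun_pred contfun_subring.
HB.instance Definition _ :=
  GRing.isSubmodClosed.Build C (X -> C) contfun_pred contfun_submod.

Record contfun := ContFun {
  contfun_val :> X -> C ;
  contfunP : contfun_val \in contfun_pred }.

HB.instance Definition _ := [isSub for contfun_val].
HB.instance Definition _ := [Choice of contfun by <:].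
HB.instance Definition _ :=
  GRing.SubChoice_isSubComPzRing.Build _ _ contfun (subringClosedP _).
HB.instance Definition _ := [SubZmodule_isSubLmodule of contfun by <:].

Lemma contfun_continuous (f : contfun) : continuous f.
Proof. by case: f => f /= /asboolP. Qed.

Lemma contfun_conj_subproof (f : contfun) :
  (fun x => (f x)^*) \in contfun_pred.
Proof.
apply/asboolP => x; apply/cvgrPdist_lt => e e0.
have /cvgrPdist_lt/(_ e e0) := @contfun_continuous f x.
by apply: filterS => y; rewrite -rmorphB /= norm_conjC.
Qed.

Definition contfun_conj (f : contfun) : contfun :=
  ContFun (contfun_conj_subproof f).

End ContFun.

Section ContFunComp.
Variables (R : realType) (X Y : topologicalType).

Lemma contfun_comp_subproof (f : contfun R Y) (h : X -> Y) :
  continuous h -> (f \o h) \in @contfun_pred R X.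
Proof.
move=> ch; apply/asboolP => x.
by apply: continuous_comp; [exact: ch | exact: contfun_continuous].
Qed.

Definition contfun_comp (f : contfun R Y) (h : X -> Y) (ch : continuous h) :
  contfun R X := ContFun (contfun_comp_subproof f ch).

End ContFunComp.

(** * Homeomorphisms of period p, fixed points and orbit spaces *)

Definition homeomorphism (X Y : topologicalType) (f : X -> Y) : Prop :=
  continuous f /\
  exists g : Y -> X, [/\ continuous g, cancel f g & cancel g f].

Definition has_period (p : nat) (T : Type) (f : T -> T) : Prop :=
  iter p f = id /\ f <> id.

(* In C*-algebraic usage a compact Hausdorff space is separable when C(X) is a
   separable C*-algebra, that is, when X is second countable.  A countable dense
   subset alone is a weaker condition. *)
Definition separable_compact_hausdorff (X : topologicalType) : Prop :=
  [/\ compact [set: X], hausdorff_space X & @second_countable X].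

Section Orbits.
Variables (M : topologicalType) (theta : M -> M).

Definition fixed_points : set M := [set x | theta x = x].

(* When theta is invertible this says theta^k x = y for some integer k; taking
   two exponents makes it an equivalence relation for every theta. *)
Definition same_orbit (x y : M) : bool :=
  `[< exists m n, iter m theta x = iter n theta y >].

Lemma same_orbit_refl : reflexive same_orbit.
Proof. by move=> x; apply/asboolP; exists 0, 0. Qed.

Lemma same_orbit_sym : symmetric same_orbit.
Proof. by move=> x y; apply/asboolP/asboolP => -[m [n e]]; exists n, m. Qed.

Lemma same_orbit_trans : transitive same_orbit.
Proof.
move=> y x z /asboolP[m [n e]] /asboolP[m' [n' e']]; apply/asboolP.
exists (m' + m)%N, (n + n')%N.
by rewrite iterD e -iterD addnC iterD e' -iterD.
Qed.

Canonical same_orbit_equiv :=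
  EquivRel same_orbit same_orbit_refl same_orbit_sym same_orbit_trans.

(* M/theta *)
Definition orbit_space : topologicalType :=
  quotient_topology {eq_quot same_orbit_equiv}.

Definition orbit_proj (x : M) : orbit_space := \pi_{eq_quot same_orbit_equiv} x.

(* M_theta inside M/theta *)
Definition fixed_orbits : set orbit_space := orbit_proj @` fixed_points.

(* M_0/theta, with the subspace topology of M/theta *)
Definition free_orbit_space : topologicalType :=
  set_type (orbit_proj @` ~` fixed_points).

End Orbits.

Arguments orbit_proj {M} theta x.
Arguments fixed_orbits {M} theta.

(** * Covering dimension *)

Definition finite_open_cover (X : topologicalType) (U : set (set X)) : Prop :=
  [/\ finite_set U, U `<=` open & \bigcup_(A in U) A = setT].

Definition covering_dim_le (X : topologicalType) (n : nat) : Prop :=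
  forall U : set (set X), finite_open_cover U ->
  exists V : set (set X),
    [/\ finite_open_cover V,
        forall B, V B -> exists2 A, U A & B `<=` A
      & forall x, ([set B | V B /\ B x] #<= `I_n.+1)%card].

(** * Stone-Cech compactification and corona *)

Section StoneCech.
Variables (R : realType) (X : topologicalType).

Definition unit_fun := {f : X -> R | continuous f /\ range f `<=` `[0, 1]}.

Definition stone_cech_eval (x : X) : prod_topology (fun _ : unit_fun => R) :=
  fun f => sval f x.

(* Tychonoff's construction: for X completely regular Hausdorff,
   stone_cech_eval embeds X densely in beta(X). *)
Definition stone_cech := closure (range stone_cech_eval).

(* chi(X) = beta(X) \ X *)
Definition corona : topologicalType :=
  set_type (stone_cech `\` range stone_cech_eval).

End StoneCech.

(** * Cech cohomology with integer coefficients *)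

(* The Cech groups are the colimit, over open covers, of the simplicial
   cohomology of the nerve.  As in Godement, covers are indexed by the points of
   X, with x in U x; such covers are cofinal, and are refined through
   V x `<=` U x, so that the transition maps are plain restrictions.  A cochain on
   a nerve is the restriction of a function on all tuples of points, and since a
   directed colimit is exact, the colimit is the quotient of the functions that
   are cocycles on some nerve by those that are coboundaries on some nerve. *)
Section Cech.
Variable X : topologicalType.

Definition pointed_cover (U : X -> set X) : Prop :=
  forall x, open_nbhs x (U x).

Definition nerve (U : X -> set X) (n : nat) : set ('I_n.+1 -> X) :=
  [set s | \bigcap_i U (s i) !=set0].

Definition cochain (n : nat) := ('I_n.+1 -> X) -> int.

Definition cobord (n : nat) (c : cochain n) : cochain n.+1 :=
  fun s => \sum_(i < n.+2) (-1) ^+ i * c (s \o lift i).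

Definition cech_cocycle (n : nat) (c : cochain n) : Prop :=
  exists2 U, pointed_cover U & forall s, nerve U s -> cobord c s = 0.

Definition cech_coboundary (n : nat) : cochain n -> Prop :=
  match n with
  | 0 => fun c =>
      exists2 U, pointed_cover U & forall s, nerve U s -> c s = 0
  | m.+1 => fun c =>
      exists b : cochain m,
      exists2 U, pointed_cover U & forall s, nerve U s -> c s = cobord b s
  end.

Lemma cobordB n (b c : cochain n) : cobord (b - c) = cobord b - cobord c.
Proof.
apply/funext => s; rewrite /cobord.
rewrite [RHS](_ : _ = cobord b s - cobord c s)// /cobord -sumrB.
by apply: eq_bigr => i _; rewrite -mulrBr.
Qed.

Lemma cobord0 n : cobord (0 : cochain n) = 0.
Proof. by rewrite -[X in cobord X](subrr (0 : cochain n)) cobordB subrr. Qed.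

Lemma pointed_coverI U V : pointed_cover U -> pointed_cover V ->
  pointed_cover (fun x => U x `&` V x).
Proof. by move=> cU cV x; exact: open_nbhsI. Qed.

Lemma pointed_coverT : pointed_cover (fun=> setT).
Proof. by move=> x; split => //; exact: openT. Qed.

Lemma nerveI U V n s : @nerve (fun x => U x `&` V x) n s ->
  nerve U s /\ nerve V s.
Proof. by case=> y yUV; split; exists y => i _; have [] := yUV i Logic.I. Qed.

Lemma cech_coboundary0 n : cech_coboundary (0 : cochain n).
Proof.
case: n => [|m] /=; first by exists (fun=> setT) => //; exact: pointed_coverT.
exists 0, (fun=> setT); first exact: pointed_coverT.
by move=> s _; rewrite cobord0.
Qed.

Lemma cech_coboundaryB n (b c : cochain n) :
  cech_coboundary b -> cech_coboundary c -> cech_coboundary (b - c).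
Proof.
case: n b c => [|m] b c /=.
  move=> [U cU bU] [V cV cV0]; exists (fun x => U x `&` V x).
    exact: pointed_coverI.
  move=> s /nerveI[sU sV].
  by rewrite [LHS](_ : _ = b s - c s)// bU// cV0// subrr.
move=> [b' [U cU bU]] [c' [V cV cV0]].
exists (b' - c'), (fun x => U x `&` V x); first exact: pointed_coverI.
move=> s /nerveI[sU sV]; rewrite cobordB.
by rewrite [LHS](_ : _ = b s - c s)// bU// cV0.
Qed.

Variable n : nat.

Definition cocycle_pred : {pred cochain n} := fun c => `[< cech_cocycle c >].

Lemma cocycle_zmod : zmod_closed cocycle_pred.
Proof.
split.
  apply/asboolP; exists (fun=> setT); first exact: pointed_coverT.
  by move=> s _; rewrite cobord0.
move=> b c /asboolP[U cU bU] /asboolP[V cV bV]; apply/asboolP.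
exists (fun x => U x `&` V x); first exact: pointed_coverI.
move=> s /nerveI[sU sV]; rewrite cobordB.
by rewrite [LHS](_ : _ = cobord b s - cobord c s)// bU// bV// subrr.
Qed.

HB.instance Definition _ :=
  GRing.isZmodClosed.Build (cochain n) cocycle_pred cocycle_zmod.

Record cocycle := Cocycle {
  cocycle_val :> cochain n ;
  cocycleP : cocycle_val \in cocycle_pred }.

HB.instance Definition _ := [isSub for cocycle_val].
HB.instance Definition _ := [Choice of cocycle by <:].
HB.instance Definition _ := [SubChoice_isSubZmodule of cocycle by <:].

Definition coboundary_pred : {pred cocycle} :=
  fun c => `[< cech_coboundary c >].

Lemma coboundary_zmod : zmod_closed coboundary_pred.
Proof.
split; first by apply/asboolP; exact: cech_coboundary0.
by move=> b c /asboolP hb /asboolP hc; apply/asboolP; exact: cech_coboundaryB.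
Qed.

HB.instance Definition _ :=
  GRing.isZmodClosed.Build cocycle coboundary_pred coboundary_zmod.

Definition cech_cohomology : zmodType := Quotient.quot coboundary_pred.

End Cech.

Definition trivial_group (V : zmodType) : Prop := forall v : V, v = 0.

(* For locally compact, non-compact X the cohomology convention is that of
   the one-point compactification. *)
Definition cech_cohomology_lc (n : nat) (X : topologicalType) : zmodType :=
  cech_cohomology (one_point_compactification X) n.

(** * The crossed product C(M) x_theta Z_p *)

(* Since Z_p is finite, the functions Z_p -> C(M) with twisted convolution
   already form the whole crossed product C*-algebra, without completion; a
   stands for \sum_k a k u^k where u f u^* = theta(f).  A *-isomorphism of
   C*-algebras is a bijective *-homomorphism, so no norm is needed. *)
Section CrossedProduct.
Variables (R : realType) (p : nat) (M : topologicalType) (theta : M -> M).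
Hypothesis theta_cont : continuous theta.

Lemma iter_continuous k : continuous (iter k theta).
Proof.
elim: k => [|k IH] x; first exact: cvg_id.
by apply: (@continuous_comp _ _ _ (iter k theta) theta);
  [exact: IH|exact: theta_cont].
Qed.

Definition act (k : 'Z_p) (f : contfun R M) : contfun R M :=
  contfun_comp f (@iter_continuous k).

Definition crossed_product : lmodType (Cplx R) := 'Z_p -> contfun R M.

Definition crossed_mul (a b : crossed_product) : crossed_product :=
  fun k => \sum_(i : 'Z_p) a i * act i (b (k - i)).

Definition crossed_star (a : crossed_product) : crossed_product :=
  fun k => act k (contfun_conj (a (- k))).

End CrossedProduct.

(** * The algebra A(M_theta) *)

Section Matrices.
Variables (R : realType) (p : nat) (X : topologicalType).

Definition mx_scale (k : Cplx R) (A : 'M[contfun R X]_p) : 'M[contfun R X]_p :=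
  map_mx (fun f => k *: f) A.

Definition mx_star (A : 'M[contfun R X]_p) : 'M[contfun R X]_p :=
  (map_mx (@contfun_conj R X) A)^T.

(* The matrices over C(X) that are diagonal at every point of F; for
   X = M/theta and F = M_theta this is A(M_theta). *)
Definition diagonal_on (F : set X) : set 'M[contfun R X]_p :=
  [set A : 'M[contfun R X]_p |
    forall x, F x -> forall i j : 'I_p, i != j -> A i j x = 0].

End Matrices.

Definition star_isomorphic_to_matrices (R : realType) (p : nat)
    (M : topologicalType) (theta : M -> M) (theta_cont : continuous theta)
    (X : topologicalType) (S : set 'M[contfun R X]_p) : Prop :=
  exists Phi : crossed_product R p M -> 'M[contfun R X]_p,
    [/\ forall a b, Phi (a + b) = Phi a + Phi b,
        forall k a, Phi (k *: a) = mx_scale k (Phi a),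
        forall a b, Phi (crossed_mul theta_cont a b) = Phi a *m Phi b,
        forall a, Phi (crossed_star theta_cont a) = mx_star (Phi a)
      & injective Phi /\ range Phi = S].

(* Main.v *)
Require Import Defs.
From mathcomp Require Import all_boot all_order all_algebra finmap.
From mathcomp Require Import generic_quotient ring_quotient complex.
From mathcomp Require Import all_classical all_reals all_analysis.
From mathcomp Require Import ring lra.

Set Implicit Arguments.
Unset Strict Implicit.
Unset Printing Implicit Defensive.

Import Order.TTheory GRing.Theory Num.Theory.
Import numFieldTopology.Exports numFieldNormedType.Exports.

Local Open Scope classical_set_scope.
Local Open Scope ring_scope.

(* Let w be a primitive p-th root of unity.  On the orbit of x the crossed
   product acts by p x p matrices; after diagonalizing the cyclic shift, the
   (i, j) entry of an element is a function h_ij on M with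
   h_ij (theta x) = w^(i-j) h_ij x.  Given a unimodular function g on M_0 with
   g (theta x) = w g x, the functions g^-(i-j) h_ij descend to M/theta, and since
   the off-diagonal h_ij vanish on M_theta they stay continuous there although g
   does not extend.  So everything reduces to the existence of g, that is, to the
   triviality of a flat line bundle L on X = M_0/theta.

   Because dim M <= 2, there are finitely many continuous h_i on M_0 with
   h_i (theta x) = w h_i x and sum |h_i|^2 = 1.  The products h_i h_j^* descend to
   bounded functions on X, hence extend to beta(X): L becomes the range of a rank
   one projection over beta(X).  As H^2 of the corona vanishes, L is trivial over
   the corona, hence, by Tietze, outside a compact set of X; it is therefore the
   restriction of a line bundle over X^+, which is trivial as H^2(X^+) = 0. *)

(** * Complex numbers and angles *)

(** Line bundles are encoded by rank one projections [v i * (v j)^*], where [v] is a unit vector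
    field with [v (theta x) = w * v x]. The phase cancels, so the entries live on the quotient, and
    they are bounded by 1, as extension to beta(X) requires. A trivialization is a factorization
    [s i * (s j)^*] of the same matrix; the scalar product of [s] and [v] is then equivariant
    because [v] is, and of modulus |s|^2 = 1. The obstruction to factoring is read off from phases.
    Real lifts of the phases of the transition functions have an integral coboundary; once this
    2-cocycle is a coboundary, the lifts can be corrected by integers and split by a partition of
    unity. H^2(X^+) = 0 does not trivialize L by itself, because L need not extend to X^+. The
    corona supplies a trivialization only at infinity; extended to X it is merely approximate, but
    near infinity it still pairs with the frame to a function without zeros. Blended into the frame
    as an additional coordinate, this function makes the projection constant near infinity, and a
    constant projection does extend. *)

Section ComplexFunctions.
Variable R : realType.
Local Notation C := (Cplx R).

Definition toC (r : R) : C := r%:C%C.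
Definition ReC (z : C) : R := complex.Re z.
Definition ImC (z : C) : R := complex.Im z.
(** [|z|] has type [C]; estimates and real-valued continuity need the modulus in [R]. *)
Definition modC (z : C) : R := ReC `|z|.

Lemma toCD a b : toC (a + b) = toC a + toC b.
Proof. by rewrite /toC rmorphD. Qed.
Lemma toCN a : toC (- a) = - toC a.
Proof. by rewrite /toC rmorphN. Qed.
Lemma toCM a b : toC (a * b) = toC a * toC b.
Proof. by rewrite /toC rmorphM. Qed.
Lemma toC0 : toC 0 = 0. Proof. by []. Qed.
Lemma toC1 : toC 1 = 1. Proof. by []. Qed.
Lemma toC_inj : injective toC.
Proof. by move=> a b []. Qed.
Lemma toC_le a b : (toC a <= toC b) = (a <= b).
Proof. exact: lecR. Qed.
Lemma toC_lt a b : (toC a < toC b) = (a < b).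
Proof. exact: ltcR. Qed.
Lemma toC_eq0 a : (toC a == 0) = (a == 0).
Proof. by rewrite -(inj_eq toC_inj). Qed.
Lemma norm_toC a : `|toC a| = toC `|a|.
Proof. by rewrite /toC normc_def/= expr0n/= addr0 sqrtr_sqr. Qed.
Lemma ReCK a : ReC (toC a) = a. Proof. by []. Qed.
Lemma ge0_toC (z : C) : 0 <= z -> z = toC (ReC z).
Proof.
by move=> z0; rewrite /toC /ReC RRe_real// ger0_real.
Qed.
Lemma modCE z : toC (modC z) = `|z|.
Proof. by rewrite -ge0_toC. Qed.
Lemma modC_ge0 z : 0 <= modC z.
Proof. by rewrite -toC_le modCE; exact: normr_ge0. Qed.
Lemma modC_eq0 z : (modC z == 0) = (z == 0).
Proof. by rewrite -(inj_eq toC_inj) modCE normr_eq0. Qed.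
Lemma modC_gt0 z : (0 < modC z) = (z != 0).
Proof. by rewrite lt_neqAle modC_ge0 andbT eq_sym modC_eq0. Qed.
Lemma modCM : {morph modC : x y / x * y}.
Proof. by move=> x y; apply: toC_inj; rewrite toCM !modCE normrM. Qed.
Lemma conj_toC a : (toC a)^* = toC a.
Proof. exact: conjc_real. Qed.
Lemma mul_conjE (z : C) : z * z^* = toC (modC z ^+ 2).
Proof. by rewrite expr2 toCM modCE -normCK expr2. Qed.
Lemma unit_modC (z : C) : z * z^* = 1 -> modC z = 1.
Proof.
rewrite mul_conjE => /(congr1 ReC)/eqP.
by rewrite ReCK sqrp_eq1 ?modC_ge0// => /eqP.
Qed.
Lemma complexRI (z : C) : z = toC (ReC z) + 'i%C * toC (ImC z).
Proof. exact: complexE. Qed.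

Lemma toC_cvgP (T : Type) (F : set_system T) {FF : Filter F} (f : T -> R) l :
  (toC (f x)) @[x --> F] --> toC l <-> f x @[x --> F] --> l.
Proof.
split.
  move=> /cvgrPdist_lt H; apply/cvgrPdist_lt => e e0.
  have /H : 0 < toC e by rewrite -toC0 toC_lt.
  by apply: filterS => t; rewrite -toCN -toCD norm_toC toC_lt.
move=> /cvgrPdist_lt H; apply/cvgrPdist_lt => e e0.
have ee := ge0_toC (ltW e0); move: e0; rewrite ee -toC0 toC_lt => /H.
by apply: filterS => t; rewrite -toCN -toCD norm_toC toC_lt.
Qed.

Lemma toC_cont : continuous toC.
Proof. by move=> x; apply/toC_cvgP; exact: cvg_id. Qed.

Lemma near_distC (z e : C) : 0 < e -> \forall w \near z, `|z - w| < e.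
Proof.
move=> e0; have FF : Filter (nbhs z) by exact: nbhs_filter.
have /cvgrPdist_lt/(_ _ e0) := @cvg_id _ (nbhs z).
exact.
Qed.

Lemma ReC_cont : continuous ReC.
Proof.
move=> z; have FF : Filter (nbhs z) by exact: nbhs_filter.
apply/cvgrPdist_lt => e e0.
have e0' : 0 < toC e by rewrite -toC0 toC_lt.
have := near_distC z e0'.
apply: filterS => w /(le_lt_trans (normc_ge_Re _)).
by rewrite -[X in X < _]/(toC _) toC_lt /= /ReC raddfB.
Qed.

Lemma normc_ge_Im (z : C) : toC `|ImC z| <= `|z|.
Proof.
have i1 : `|'i%C : C| = 1.
  by rewrite normc_def; apply/eqP; rewrite eq_complex/= expr0n expr1n add0r sqrtr1 !eqxx.
rewrite -[Num.norm z]mulr1 -i1 -normrM.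
apply: le_trans (normc_ge_Re _).
by rewrite ReiNIm normrN.
Qed.

Lemma ImC_cont : continuous ImC.
Proof.
move=> z; have FF : Filter (nbhs z) by exact: nbhs_filter.
apply/cvgrPdist_lt => e e0.
have e0' : 0 < toC e by rewrite -toC0 toC_lt.
have := near_distC z e0'.
apply: filterS => w /(le_lt_trans (normc_ge_Im _)).
by rewrite toC_lt /= /ImC raddfB.
Qed.

Lemma conjC_cont : continuous (fun z : C => z^*).
Proof.
move=> x; have FF : Filter (nbhs x) by exact: nbhs_filter.
apply/cvgrPdist_lt => e e0.
have := near_distC x e0.
by apply: filterS => y; rewrite -rmorphB /= norm_conjC.
Qed.

Lemma modC_cont : continuous modC.
Proof.
move=> x; suff : {for x, continuous (@ReC \o (fun z : C => `|z| : C))} by [].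
apply: continuous_comp; last exact: ReC_cont.
exact: (@norm_continuous C C).
Qed.

Lemma complex_continuous (Z : topologicalType) (a b : Z -> R) :
  continuous a -> continuous b -> continuous (fun z => toC (a z) + 'i%C * toC (b z)).
Proof.
move=> ca cb z; apply: cvgD.
  by apply: (@continuous_comp _ _ _ a toC); [exact: ca|exact: toC_cont].
apply: cvgM; first exact: cvg_cst.
by apply: (@continuous_comp _ _ _ b toC); [exact: cb|exact: toC_cont].
Qed.

Lemma mulC_continuous (Z : topologicalType) (a b : Z -> C) :
  continuous a -> continuous b -> continuous (fun z => a z * b z).
Proof. by move=> ca cb z; apply: cvgM; [exact: ca|exact: cb]. Qed.

Lemma conj_continuous (Z : topologicalType) (a : Z -> C) :
  continuous a -> continuous (fun z => (a z)^*).
Proof.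
by move=> ca z; apply: (@continuous_comp _ _ _ a); [exact: ca|exact: conjC_cont].
Qed.

(** Angles are counted in full turns, so that the kernel is exactly the integers and integral
    cocycles appear without a factor 2 pi. *)
Definition turn (t : R) : C := Complex (cos (2 * pi * t)) (sin (2 * pi * t)).

Lemma turnD s t : turn (s + t) = turn s * turn t.
Proof.
rewrite /turn mulrDr cosD sinD; apply/eqP; rewrite eq_complex /=.
by rewrite eqxx/= addrC.
Qed.

Lemma turn0 : turn 0 = 1.
Proof. by rewrite /turn mulr0 cos0 sin0. Qed.

Lemma modC_turn t : modC (turn t) = 1.
Proof.
by apply: toC_inj; rewrite modCE normc_def /= cos2Dsin2 sqrtr1.
Qed.

Lemma turn_conj t : (turn t)^* = turn (- t).
Proof. by rewrite /turn mulrN cosN sinN. Qed.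

Lemma turn_mul_conj t : turn t * (turn t)^* = 1.
Proof. by rewrite mul_conjE modC_turn expr1n. Qed.

Lemma turn_cont : continuous turn.
Proof.
move=> t.
have c1 : {for t, continuous (fun t : R => 2 * pi * t)}.
  by apply: (@continuousM R R (cst (2 * pi)) id); [exact: cst_continuous|].
rewrite (_ : turn = (fun t => toC (cos (2 * pi * t)) + 'i%C * toC (sin (2 * pi * t)))); last first.
  by apply/funext => s; rewrite [LHS]complexRI.
apply: cvgD.
  apply/toC_cvgP.
  by apply: (@continuous_comp _ _ _ (fun t : R => 2 * pi * t) cos) => //; exact: continuous_cos.
apply: cvgM; first exact: cvg_cst.
apply/toC_cvgP.
by apply: (@continuous_comp _ _ _ (fun t : R => 2 * pi * t) sin) => //; exact: continuous_sin.
Qed.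

Lemma turn_int (n : int) : turn n%:~R = 1.
Proof.
have turnN (m : nat) : turn m%:R = 1.
  elim: m => [|m IH]; first exact: turn0.
  by rewrite -natr1 turnD IH mul1r /turn mulr1 mulr_natl cos2pi sin2pi.
case: n => m; first exact: turnN.
by rewrite NegzE mulrNz -turn_conj (turnN m.+1) rmorph1.
Qed.

(** Only the fractional part [u] matters. As cos is injective on [0, pi] only, it is applied to [u]
    when [u <= 1/2] and to [1 - u] otherwise; the latter would give [u = 1], which is excluded. *)
Lemma turn_eq1 t : turn t = 1 -> exists n : int, t = n%:~R.
Proof.
pose u := t - (Num.floor t)%:~R.
move=> t1; exists (Num.floor t).
have : turn u = 1 by rewrite /u turnD t1 -mulrNz turn_int mulr1.
have /andP[u0 u1] : 0 <= u < 1.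
  have /andP[a b] := floor_itv t; rewrite /u subr_ge0 a/= ltrBlDl.
  by rewrite -[1]/(1%:~R) -intrD.
suff: turn u = 1 -> u = 0 by move=> h /h /eqP; rewrite subr_eq0 => /eqP.
have pi0 := pi_gt0 R.
move=> [] h _.
have [uh|uh] := lerP u (2^-1).
  have : 2 * pi * u = 0.
    apply: cos_inj; rewrite ?in_itv/= ?lexx ?(ltW pi0)//.
      by apply/andP; split; nra.
    by rewrite h cos0.
  by move/eqP; rewrite mulf_eq0 (gt_eqF _) ?mulr_gt0//= => /eqP.
have : 2 * pi * (1 - u) = 0.
  apply: cos_inj; rewrite ?in_itv/= ?lexx ?(ltW pi0)//.
    by apply/andP; split; nra.
  rewrite mulrBr mulr1 mulr_natl cosB cos2pi sin2pi.
  by rewrite mulrC mulr1 -mulr_natl h mul0r addr0 cos0.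
move/eqP; rewrite mulf_eq0 (gt_eqF _) ?mulr_gt0//= subr_eq0.
by move=> /eqP e; rewrite -e ltxx in u1.
Qed.

Lemma turn_polar (z : C) : exists t, z = toC (modC z) * turn t.
Proof.
have [->|z0] := eqVneq z 0.
  by exists 0; rewrite (_ : modC 0 = 0) ?mul0r//; apply/eqP; rewrite modC_eq0.
suff H (w : C) : modC w = 1 -> exists t, w = turn t.
  have m0 : toC (modC z) != 0 by rewrite modCE normr_eq0.
  have [|t ht] := H (z / toC (modC z)).
    apply: toC_inj; rewrite modCE normrM normfV modCE normr_id divff // normr_eq0.
  by exists t; rewrite -ht mulrC divfK.
case: w => x y w1.
have xy : x ^+ 2 + y ^+ 2 = 1.
  have : toC (modC (Complex x y)) = 1 by rewrite w1.
  rewrite modCE normc_def/= => -[] /(congr1 (fun z => z ^+ 2)).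
  by rewrite sqr_sqrtr ?expr1n// addr_ge0// sqr_ge0.
have x1 : -1 <= x <= 1 by apply/andP; split; nra.
have pi0 := pi_gt0 R.
have pi2 : 2 * pi != 0 :> R by rewrite mulf_neq0 ?gt_eqF.
have [y0|y0] := lerP 0 y.
  exists (acos x / (2 * pi)); rewrite /turn (mulrC (2 * pi)) divfK//.
  rewrite acosK ?in_itv//= sin_acos// -xy addrAC subrr add0r.
  by rewrite sqrtr_sqr ger0_norm.
exists (- acos x / (2 * pi)); rewrite /turn (mulrC (2 * pi)) divfK//.
rewrite cosN sinN acosK ?in_itv//= sin_acos// -xy addrAC subrr add0r.
by rewrite sqrtr_sqr ltr0_norm// opprK.
Qed.

(** An arbitrary argument, without any continuity. It will be evaluated at base points of a cover
    only; the variation around them is measured by [small_angle]. *)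
Definition angle (z : C) : R := projT1 (cid (turn_polar z)).
Lemma angleP z : z = toC (modC z) * turn (angle z).
Proof. exact: (projT2 (cid (turn_polar z))). Qed.

(** The principal argument, in turns, on the right half-plane. *)
Definition small_angle (z : C) : R := atan (ImC z / ReC z) / (2 * pi).

Lemma small_angleP z : 0 < ReC z -> z = toC (modC z) * turn (small_angle z).
Proof.
case: z => x y /= x0; rewrite /turn /small_angle.
have pi0 := pi_gt0 R.
have pi2 : 2 * pi != 0 :> R by rewrite mulf_neq0 ?gt_eqF.
rewrite (mulrC (2 * pi)) divfK//=.
set t := y / x.
have -> : sin (atan t) = t * cos (atan t).
  rewrite -{2}(atanK t) /tan divfK// gt_eqF// cos_gt0_pihalf//.
  by rewrite atan_gtNpi2 atan_ltpi2.
have -> : modC (Complex x y) = x * Num.sqrt (1 + t ^+ 2).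
  apply: toC_inj; rewrite modCE normc_def/=; congr toC.
  rewrite -{2}(ger0_norm (ltW x0)) -sqrtr_sqr -sqrtrM ?sqr_ge0//; congr Num.sqrt.
  by rewrite /t; field; rewrite gt_eqF.
rewrite cos_atan; set s := Num.sqrt _.
have s0 : s != 0 by rewrite gt_eqF// sqrtr_gt0 ltr_pwDl// sqr_ge0.
have e1 : x * s * s^-1 = x by rewrite mulfK.
have e2 : x * s * (t * s^-1) = y by rewrite /t; field; rewrite s0 gt_eqF.
by apply/eqP; rewrite eq_complex/= !mul0r subr0 addr0 e1 e2 !eqxx.
Qed.

Lemma small_angle_cont z : 0 < ReC z -> {for z, continuous small_angle}.
Proof.
move=> z0; apply: (@continuousM R _ (fun z => atan (ImC z / ReC z)) (cst _)).
  apply: (@continuous_comp _ _ _ (fun z => ImC z / ReC z) atan).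
    apply: (@continuousM R _ ImC (fun z => (ReC z)^-1)); first exact: ImC_cont.
    by apply: (@continuousV R _ ReC); [rewrite gt_eqF|exact: ReC_cont].
  exact: continuous_atan.
exact: cst_continuous.
Qed.

Lemma small_angle_near1 (e : R) : 0 < e ->
  exists2 d : C, 0 < d &
    forall z : C, `|z - 1| < d -> 0 < ReC z /\ `|small_angle z| < e.
Proof.
move=> e0.
have [d /= d0 H] : nbhs (1 : C) [set z | 0 < ReC z /\ `|small_angle z| < e].
  apply: filterI.
    have : {for (1 : C), continuous ReC} by exact: ReC_cont.
    by move=> /cvgr_gt; apply; exact: ltr01.
  have /cvgrPdist_lt/(_ _ e0) : {for (1 : C), continuous small_angle}.
    by apply: small_angle_cont; exact: ltr01.
  apply: filterS => z; rewrite [small_angle 1]/small_angle/=.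
  by rewrite mul0r atan0 mul0r sub0r normrN.
by exists d => // z zd; apply: H => /=; rewrite distrC.
Qed.

End ComplexFunctions.

(** * Splitting real Cech cocycles on compact spaces *)

Lemma continuous_near_eq (X Z : topologicalType) (f g : X -> Z) (x : X) :
  (\forall y \near x, f y = g y) -> {for x, continuous g} -> {for x, continuous f}.
Proof.
move=> fg cg; rewrite /prop_for /continuous_at (nbhs_singleton fg).
apply: cvg_trans cg; apply: near_eq_cvg.
by apply: filterS fg.
Qed.

(** Otherwise the sets of points of [K] missed by finitely many [U y] form a base of a proper
    filter, and a cluster point [x] of it is excluded by its own neighbourhood [U x]. *)
Lemma compact_finite_cover (T : topologicalType) (K : set T) (U : T -> set T) :
  compact K -> (forall x, K x -> nbhs x (U x)) ->
  exists s : seq T, forall x, K x -> exists2 y, y \in s & U y x.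
Proof.
move=> cK nU; apply: contrapT => noS.
pose D : set (seq T) := setT.
pose B (s : seq T) := [set x | K x /\ forall y, y \in s -> ~ U y x].
have FB : ProperFilter (filter_from D B).
  apply: filter_from_proper.
    apply: filter_from_filter; first by exists [::].
    move=> s t _ _; exists (s ++ t) => // x [Kx stx]; split; split => // y ys.
      by apply: stx; rewrite mem_cat ys.
    by apply: stx; rewrite mem_cat ys orbT.
  move=> s _; apply: contrapT => nBs; apply: noS; exists s => x Kx.
  apply: contrapT => nx; apply: nBs; exists x; split => // y ys Uyx.
  by apply: nx; exists y.
have KF : filter_from D B K by exists [::] => // x [].
have [x [Kx xF]] := cK _ FB KF.
have BF : filter_from D B (B [:: x]) by exists [:: x].
have [y [[_ /(_ x (mem_head _ _)) nUy] Uy]] := xF _ _ BF (nU x Kx).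
exact: nUy.
Qed.

(** A Urysohn function going from -1 off [W] to 1 at [y] is cut off at 0, so that it vanishes near
    every point outside [W], not merely at it. Hence its product with a function continuous only on
    [W] is continuous everywhere. *)
Lemma compact_hausdorff_bump (R : realType) (Y : topologicalType) (y : Y) (W : set Y) :
  compact [set: Y] -> hausdorff_space Y -> open_nbhs y W ->
  exists u : Y -> R, [/\ continuous u, forall z, 0 <= u z, 0 < u y &
    forall z, ~ W z -> \forall w \near z, u w = 0].
Proof.
move=> cY hY [oW Wy]; have nY := compact_normal hY cY.
have [] := @urysohn_ext_itv _ R nY (~` W) [set y] (-1) 1.
- exact: open_closedC.
- exact/accessible_closed_set1/hausdorff_accessible.
- by apply/seteqP; split => z //= [nWz zy]; apply: nWz; rewrite zy.
- by rewrite -subr_gt0 opprK addr_gt0.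
move=> f [cf f0 f1 _]; exists (fun z => Num.max (f z) 0); split.
- by move=> z; apply: continuous_max; [exact: cf|exact: cst_continuous].
- by move=> z; rewrite le_max lexx orbT.
- by rewrite lt_max (_ : f y = 1) ?ltr01//; apply: f1; exists y.
- move=> z nWz; have fz : f z = -1 by apply: f0; exists z.
  have : f z < 0 by rewrite fz oppr_lt0.
  move=> /(cvgr_lt _ (cf z)); apply: filterS => w fw.
  by apply/max_idPr; exact: ltW.
Qed.

Lemma cech_trivialP (X : topologicalType) (n : nat) (c : cochain X n.+1) :
  trivial_group (cech_cohomology X n.+1) -> cech_cocycle c -> cech_coboundary c.
Proof.
move=> H hc; have cP : c \in @cocycle_pred X n.+1 by apply/asboolP.
pose z := Cocycle cP.
have zE : ((\pi_(cech_cohomology X n.+1) z)%qT = 0)%qT by exact: H.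
have : (z == 0 %[mod {ideal_quot (@coboundary_pred X n.+1)}])%qT.
  apply/eqP; rewrite [LHS]zE; symmetry; exact: H.
rewrite -Quotient.idealrBE => /asboolP.
by rewrite subr0.
Qed.

Lemma sum_continuous (R : numFieldType) (X : topologicalType) (I : Type) (r : seq I)
    (F : I -> X -> R) (x : X) :
  (forall i, {for x, continuous (F i)}) ->
  {for x, continuous (fun w => \sum_(i <- r) F i w)}.
Proof.
move=> cF; elim: r => [|i r IH].
  rewrite (_ : (fun w => _) = cst 0); first exact: cst_continuous.
  by apply/funext => w; rewrite big_nil.
rewrite (_ : (fun w => _) = (fun w => F i w + \sum_(j <- r) F j w)).
  by apply: cvgD; [exact: cF|exact: IH].
by apply/funext => w; rewrite big_cons.
Qed.

Section RealCocycle.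
Variables (R : realType) (Y : topologicalType).
Hypotheses (cY : compact [set: Y]) (hY : hausdorff_space Y).

(** [phi y] is the mean of the functions [th y z] over [z], weighted by a partition of unity
    subordinate to [W]. By additivity each term of [phi y - phi z] is the weight times [th y z]. *)
Lemma partition_splitting (W : Y -> set Y) (th : Y -> Y -> Y -> R) :
  pointed_cover W ->
  (forall y z w, W y w -> W z w -> {for w, continuous (th y z)}) ->
  (forall x y z w, W x w -> W y w -> W z w ->
     th x y w + th y z w = th x z w) ->
  exists phi : Y -> Y -> R,
    (forall y w, W y w -> {for w, continuous (phi y)}) /\
    (forall y z w, W y w -> W z w -> phi y w - phi z w = th y z w).
Proof.
move=> cW cth thD.
have bmp y := @compact_hausdorff_bump R Y y (W y) cY hY (cW y).
pose u y := projT1 (cid (bmp y)).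
have uP y : [/\ continuous (u y), forall z, 0 <= u y z, 0 < u y y &
    forall z, ~ W y z -> \forall w \near z, u y w = 0] := projT2 (cid (bmp y)).
have [|l lP] := @compact_finite_cover Y setT (fun y => [set w | 0 < u y w]) cY.
  move=> y _; have [cu _ uy _] := uP y.
  exact: (cvgr_gt _ (cu y)).
pose S w := \sum_(y <- l) u y w.
have S0 w : 0 < S w.
  have [//|y yl uyw] := lP w.
  rewrite /S (big_rem y)//= ltr_pwDl// sumr_ge0// => z _.
  by have [] := uP z.
have cS : continuous S.
  by move=> w; apply: sum_continuous => z; have [+ _ _ _] := uP z; exact.
have uW z w : u z w != 0 -> W z w.
  move=> uzw; apply: contrapT => nW; have [_ _ _ /(_ w nW)/nbhs_singleton] := uP z.
  by move=> /eqP; apply/negP.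
exists (fun y w => (\sum_(z <- l) u z w * th y z w) / S w); split.
  move=> y w Wyw; apply: cvgM; last first.
    by apply: continuousV; [rewrite gt_eqF|exact: cS].
  apply: sum_continuous => z; have [cu _ _ u0] := uP z.
  have [Wzw|nWzw] := pselect (W z w).
    by apply: cvgM; [exact: cu|exact: cth].
  apply: (@continuous_near_eq _ _ _ (cst 0)); last exact: cst_continuous.
  by apply: filterS (u0 _ nWzw) => v ->; rewrite mul0r.
move=> y z w Wyw Wzw; rewrite -mulrBl -sumrB.
rewrite (eq_bigr (fun x => u x w * th y z w)); last first.
  move=> x _; have [->|uxw] := eqVneq (u x w) 0; first by rewrite !mul0r subrr.
  have Wxw := uW _ _ uxw.
  by rewrite -mulrBr -(thD y z x w)// addrK.
by rewrite -mulr_suml -/(S w) mulrAC divff ?mul1r// gt_eqF.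
Qed.

Let tup n (x : Y) (l : seq Y) : 'I_n -> Y := fun i => nth x l i.

(* The coboundary of [th] is integral and, by the bound on [th - a], constant on
   each triple intersection, so it is an integral 2-cocycle.  Correcting [th] by an
   integral cochain makes it a real cocycle, which a partition of unity splits. *)
Lemma real_cocycle_splitting (U : Y -> set Y) (th : Y -> Y -> Y -> R)
    (a : Y -> Y -> R) :
  trivial_group (cech_cohomology Y 2) ->
  pointed_cover U ->
  (forall y z w, U y w -> U z w -> {for w, continuous (th y z)}) ->
  (forall y z w, U y w -> U z w -> `|th y z w - a y z| < 10^-1) ->
  (forall x y z w, U x w -> U y w -> U z w ->
     exists n : int, th x y w - th x z w + th y z w = n%:~R) ->
  exists (W : Y -> set Y) (phi : Y -> Y -> R),
    [/\ pointed_cover W, (forall y, W y `<=` U y),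
     (forall y w, W y w -> {for w, continuous (phi y)}) &
     (forall y z w, W y w -> W z w ->
       exists n : int, phi y w - phi z w = th y z w + n%:~R)].
Proof.
move=> H2 cU cth tha thZ.
pose o0 := @Ordinal 3 0 isT; pose o1 := @Ordinal 3 1 isT; pose o2 := @Ordinal 3 2 isT.
pose dth (s : 'I_3 -> Y) w : R :=
  th (s o0) (s o1) w - th (s o0) (s o2) w + th (s o1) (s o2) w.
pose c : cochain Y 2 := fun s =>
  if pselect (nerve U s) is left h then Num.floor (dth s (projT1 (cid h))) else 0.
have cE s w : (forall i, U (s i) w) -> (c s)%:~R = dth s w.
  move=> sw; rewrite /c; case: pselect => [h|]; last first.
    by move=> []; exists w => i _; exact: sw.
  case: cid => v /= vU.
  have Uv i : U (s i) v by exact: vU.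
  have [m mE] := thZ _ _ _ _ (sw o0) (sw o1) (sw o2).
  have [n nE] := thZ _ _ _ _ (Uv o0) (Uv o1) (Uv o2).
  rewrite /dth mE nE intrKfloor.
  (* Each of the three values of [th] moves by less than 2/10 between [w] and [v], so the integers
     [n] and [m] differ by less than 6/10. *)
  suff : `|(n - m)%:~R : R| < 1.
    rewrite -intr_norm -[1]/(1%:~R) ltr_int -[1]add0r ltzD1 normr_le0 subr_eq0.
    by move=> /eqP ->.
  rewrite rmorphB /= -mE -nE.
  have := tha _ _ _ (sw o0) (sw o1); have := tha _ _ _ (sw o0) (sw o2).
  have := tha _ _ _ (sw o1) (sw o2); have := tha _ _ _ (Uv o0) (Uv o1).
  have := tha _ _ _ (Uv o0) (Uv o2); have := tha _ _ _ (Uv o1) (Uv o2).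
  rewrite !ltr_norml; lra.
have cc : cech_cocycle c.
  exists U => // s [w wU].
  have Uw i : U (s i) w by exact: wU.
  pose q0 := @Ordinal 4 0 isT; pose q1 := @Ordinal 4 1 isT.
  pose q2 := @Ordinal 4 2 isT; pose q3 := @Ordinal 4 3 isT.
  have -> : cobord c s = c (s \o lift q0) - c (s \o lift q1)
      + c (s \o lift q2) - c (s \o lift q3).
    rewrite /cobord !big_ord_recl big_ord0.
    have -> : lift ord0 (lift ord0 (lift ord0 ord0)) = q3 by exact: val_inj.
    have -> : lift ord0 (lift ord0 ord0) = q2 by exact: val_inj.
    have -> : lift ord0 ord0 = q1 by exact: val_inj.
    have -> : ord0 = q0 by exact: val_inj.
    by rewrite /= expr0 expr1 -signr_odd /= expr0 -signr_odd /= expr1; ring.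
  apply: (@intr_inj R); rewrite !(rmorphB, rmorphD)/= !(cE _ w); try (by move=> i; exact: Uw).
  rewrite /dth /=.
  have -> : lift q0 o0 = q1 by exact: val_inj.
  have -> : lift q0 o1 = q2 by exact: val_inj.
  have -> : lift q0 o2 = q3 by exact: val_inj.
  have -> : lift q1 o0 = q0 by exact: val_inj.
  have -> : lift q1 o1 = q2 by exact: val_inj.
  have -> : lift q1 o2 = q3 by exact: val_inj.
  have -> : lift q2 o0 = q0 by exact: val_inj.
  have -> : lift q2 o1 = q1 by exact: val_inj.
  have -> : lift q2 o2 = q3 by exact: val_inj.
  have -> : lift q3 o0 = q0 by exact: val_inj.
  have -> : lift q3 o1 = q1 by exact: val_inj.
  have -> : lift q3 o2 = q2 by exact: val_inj.
  by ring.
have [b [V cV bV]] := cech_trivialP H2 cc.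
pose b2 y z := b (tup y [:: y; z] : 'I_2 -> Y).
pose W y := U y `&` V y.
have cbE x y z w : W x w -> W y w -> W z w ->
    th x y w - th x z w + th y z w = (b2 x y - b2 x z + b2 y z)%:~R.
  move=> [Ux Vx] [Uy Vy] [Uz Vz]; pose s : 'I_3 -> Y := tup x [:: x; y; z].
  have -> : th x y w - th x z w + th y z w = dth s w by [].
  rewrite -cE; last by move=> [[|[|[|i]]] hi].
  rewrite bV; last by exists w => -[[|[|[|i]]] hi].
  congr _%:~R; rewrite /cobord !big_ord_recl big_ord0.
  have -> : lift ord0 (lift ord0 ord0) = o2 by exact: val_inj.
  have -> : lift ord0 ord0 = o1 by exact: val_inj.
  have -> : ord0 = o0 by exact: val_inj.
  have -> : s \o lift o0 = tup y [:: y; z].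
    by apply/funext => -[[|[|i]] hi].
  have -> : s \o lift o1 = tup x [:: x; z].
    by apply/funext => -[[|[|i]] hi].
  have -> : s \o lift o2 = tup x [:: x; y].
    by apply/funext => -[[|[|i]] hi].
  by rewrite /= expr0 expr1 -signr_odd /= expr0 /b2; ring.
have cW : pointed_cover W by exact: pointed_coverI.
have [|x y z w Wx Wy Wz|phi [cphi phiE]] :=
    @partition_splitting W (fun y z w => th y z w - (b2 y z)%:~R) cW.
- move=> y z w [Uy _] [Uz _]; apply: cvgB; first exact: cth.
  exact: cvg_cst.
- by have := cbE _ _ _ _ Wx Wy Wz; rewrite rmorphD rmorphB /=; lra.
exists W, phi; split => //; first by move=> y w [].
by move=> y z w Wy Wz; exists (- b2 y z); rewrite phiE// rmorphN.
Qed.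
End RealCocycle.

(** * Rank one projections over a compact space with trivial H^2 *)

Section RankOne.
Variables (R : realType) (I : finType).
Local Notation C := (Cplx R).

(* Hermitian matrices v v^*, for v a unit vector of C^I. *)
Definition rank_one_projection (P : I -> I -> C) : Prop :=
  [/\ forall i j, P j i = (P i j)^*,
      forall i j k l, P i j * P k l = P i l * P k j,
      forall i, 0 <= P i i & \sum_i P i i = 1].

Variables (Y : topologicalType) (P : I -> I -> Y -> C).
Hypotheses (cY : compact [set: Y]) (hY : hausdorff_space Y).
Hypothesis H2 : trivial_group (cech_cohomology Y 2).
Hypothesis cP : forall i j, continuous (P i j).
Hypothesis P1 : forall y, rank_one_projection (fun i j => P i j y).

Let p i y : R := ReC (P i i y).

Let pE i y : P i i y = toC (p i y).
Proof. by apply: ge0_toC; have [_ _ + _] := P1 y; exact. Qed.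

Let modP2 i j y : modC (P i j y) ^+ 2 = p i y * p j y.
Proof.
have [PJ PP _ _] := P1 y.
by apply: toC_inj; rewrite -mul_conjE -PJ PP mulrC toCM -!pE mulrC.
Qed.

(** The diagonal has sum 1, so some entry is at least 1/|I|; the successor makes the inequality
    strict. *)
Let eps : R := (#|I|.+1)%:R^-1.

Let eps_gt0 : 0 < eps.
Proof. by rewrite invr_gt0 ltr0n. Qed.

Let large_diag y : exists i, eps < p i y.
Proof.
apply: contrapT => H; have [_ _ _ PS] := P1 y.
have : \sum_i p i y = 1.
  by apply: toC_inj; rewrite -[RHS]PS /toC rmorph_sum/=; apply: eq_bigr => i _; rewrite pE.
have : \sum_i p i y <= \sum_(i : I) eps.
  by apply: ler_sum => i _; rewrite leNgt; apply/negP => pi; apply: H; exists i.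
rewrite sumr_const -[_ *+ _]mulr_natl => /[swap] ->; apply/negP; rewrite -ltNge.
by rewrite ltr_pdivrMr ?ltr0n// mul1r ltr_nat.
Qed.

Let idx y : I := projT1 (cid (large_diag y)).
Let idxP y : eps < p (idx y) y := projT2 (cid (large_diag y)).

Let cp i : continuous (p i).
Proof.
move=> y; apply: (@continuous_comp _ _ _ (P i i) (@ReC R)).
  exact: cP.
exact: ReC_cont.
Qed.

(* Over [U y] the column [idx y] of [P] is nonzero; the phase of the transition
   from [y] to [z] is that of [P (idx y) (idx z)], which varies little on [U y]. *)
Lemma rank_one_factorization : exists s : I -> Y -> C,
  (forall i, continuous (s i)) /\
  (forall i j y, P i j y = s i y * (s j y)^*).
Proof.
(* [10^-1] is the oscillation that [real_cocycle_splitting] tolerates. On overlaps the relevant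
   entries exceed [eps] in modulus, so a variation below [d * eps] keeps their quotients within [d]
   of 1. *)
have [d d0 dP] := @small_angle_near1 R 10^-1 ltac:(by rewrite invr_gt0).
have de0 : 0 < d * toC eps.
  by rewrite mulr_gt0// -toC0 toC_lt.
pose U0 y := [set w | eps < p (idx y) w /\
  forall i j, `|P i j w - P i j y| < d * toC eps].
pose U y := interior (U0 y).
have UU0 y : U y `<=` U0 y by exact: interior_subset.
have cU : pointed_cover U.
  move=> y; split; first exact: open_interior.
  rewrite /U /interior/=; apply: filterI.
    exact: (cvgr_gt _ (@cp (idx y) y)).
  have Hij i j : \forall w \near y, `|P i j w - P i j y| < d * toC eps.
    have /cvgrPdist_lt/(_ _ de0) := @cP i j y.
    by apply: filterS => w; rewrite distrC.
  have : \forall w \near y, forall ij : I * I,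
      `|P ij.1 ij.2 w - P ij.1 ij.2 y| < d * toC eps.
    by apply: filter_forall => ij; exact: Hij.
  by apply: filterS => w H i j; exact: (H (i, j)).
have modP_gt y z w : U y w -> U z w -> eps < modC (P (idx y) (idx z) w).
  move=> /UU0[yw _] /UU0[zw _].
  rewrite -(@ltr_pXn2r _ 2%N)// ?nnegrE ?modC_ge0 ?(ltW eps_gt0)//.
  by rewrite modP2 expr2 ltr_pM// ltW.
pose q y z w := P (idx y) (idx z) y / P (idx y) (idx z) w.
(* The lift of the phase is arbitrary at the base point [y], where it is a constant, and is
   continued to [w] through the quotient [q], which stays in the right half-plane. *)
pose th y z w := angle (P (idx y) (idx z) y) - small_angle (q y z w).
have P_neq0 y z w : U y w -> U z w -> P (idx y) (idx z) w != 0.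
  by move=> yw zw; rewrite -modC_gt0 (lt_trans eps_gt0)// modP_gt.
have qP y z w : U y w -> U z w -> 0 < ReC (q y z w) /\ `|small_angle (q y z w)| < 10^-1.
  move=> yw zw; apply: dP; have P0 := P_neq0 _ _ _ yw zw.
  rewrite /q -[X in _ - X](divff P0) -mulrBl normrM normfV ltr_pdivrMr ?normr_gt0//.
  rewrite distrC; have [_ /(_ (idx y) (idx z))] := UU0 _ _ yw.
  move=> /lt_le_trans; apply; rewrite ler_wpM2l// ?(ltW d0)//.
  by rewrite -modCE toC_le ltW// modP_gt.
have thE y z w : U y w -> U z w ->
    P (idx y) (idx z) w = toC (modC (P (idx y) (idx z) w)) * turn (th y z w).
  move=> yw zw; have P0 := P_neq0 _ _ _ yw zw; have [q0 _] := qP _ _ _ yw zw.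
  have qn0 : q y z w != 0.
    by apply/eqP => qe; rewrite qe ltxx in q0.
  have Py : P (idx y) (idx z) y = q y z w * P (idx y) (idx z) w by rewrite /q divfK.
  have Ey := angleP (P (idx y) (idx z) y); have Eq := small_angleP q0.
  have tq : turn (small_angle (q y z w)) != 0.
    by rewrite -modC_gt0 modC_turn.
  have mq : toC (modC (q y z w)) != 0 by rewrite modCE normr_eq0.
  apply: (mulfI qn0); rewrite -Py {1}Ey {1}Py modCM toCM {2}Eq turnD -turn_conj.
  rewrite -!mulrA; congr (_ * _).
  rewrite !mulrA; rewrite [RHS](_ : _ = toC (modC (P (idx y) (idx z) w)) *
    turn (angle (P (idx y) (idx z) y)) * (turn (small_angle (q y z w)) * (turn (small_angle (q y z w)))^*)).
    by rewrite turn_mul_conj mulr1.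
  by ring.
have [|||W [phi [cW WU cphi phiE]]] :=
    @real_cocycle_splitting R Y cY hY U th (fun y z => angle (P (idx y) (idx z) y)) H2 cU.
- move=> y z w yw zw; apply: cvgB; first exact: cvg_cst.
  apply: (@continuous_comp _ _ _ (q y z) (@small_angle R)).
    apply: cvgM; first exact: cvg_cst.
    by apply: continuousV; [exact: P_neq0|exact: cP].
  by apply: small_angle_cont; have [] := qP _ _ _ yw zw.
- move=> y z w yw zw; rewrite /th addrAC subrr add0r normrN.
  by have [] := qP _ _ _ yw zw.
(* From [P_xy * P_yz = P_xz * P_yy] with [P_yy > 0], the phases multiply, so the coboundary of [th]
   has trivial image under [turn]. *)
- move=> x y z w xw yw zw; have [_ PP _ _] := P1 w.
  apply: turn_eq1; rewrite 2!turnD -turn_conj.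
  have Pxyz := PP (idx x) (idx y) (idx y) (idx z).
  have mxyz := congr1 (@modC R) Pxyz; rewrite !modCM in mxyz.
  have my : modC (P (idx y) (idx y) w) = p (idx y) w.
    by apply: toC_inj; rewrite modCE pE norm_toC ger0_norm// -toC_le -pE; have [] := P1 w.
  rewrite my in mxyz.
  rewrite (thE x y w xw yw) (thE y z w yw zw) (thE x z w xw zw) pE in Pxyz.
  have m0 : toC (modC (P (idx x) (idx z) w) * p (idx y) w) != 0.
    by rewrite toC_eq0 mulf_neq0// gt_eqF ?(lt_trans eps_gt0)//
      ?modP_gt//; have [] := UU0 _ _ yw.
  apply: (mulfI m0); rewrite mulr1 -{1}mxyz toCM.
  rewrite [LHS](_ : _ = (toC (modC (P (idx x) (idx y) w)) * turn (th x y w) *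
    (toC (modC (P (idx y) (idx z) w)) * turn (th y z w))) * (turn (th x z w))^*); last by ring.
  rewrite Pxyz toCM.
  rewrite [LHS](_ : _ = toC (modC (P (idx x) (idx z) w)) * toC (p (idx y) w) *
    (turn (th x z w) * (turn (th x z w))^*)); last by ring.
  by rewrite turn_mul_conj mulr1.
(* The normalized column [idx y] spans the line at [w], with a phase that depends on [y]. Columns
   [idx y] and [idx w] differ by the phase [th y w w], which is [phi y w - phi w w] up to an
   integer, so [turn (phi y w)] makes the local sections agree. *)
pose sect j y w := P j (idx y) w / toC (Num.sqrt (p (idx y) w)) * turn (phi y w).
have sectE j y w : W y w -> sect j y w = sect j w w.
  move=> yw; have ww : W w w by have [] := cW w.
  have [_ PP _ _] := P1 w.
  have Uyw := WU _ _ yw; have Uww := WU _ _ ww.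
  have [n nE] := phiE _ _ _ yw ww.
  have phiyE : phi y w = phi w w + th y w w + n%:~R by rewrite -addrA -nE addrC subrK.
  have py0 : 0 < p (idx y) w by rewrite (lt_trans eps_gt0)//; have [] := UU0 _ _ Uyw.
  have pw0 : 0 < p (idx w) w by rewrite (lt_trans eps_gt0)//; have [] := UU0 _ _ Uww.
  have toC0' r : 0 < r -> toC r != 0.
    by move=> r0; rewrite toC_eq0 gt_eqF.
  have sy0 : toC (Num.sqrt (p (idx y) w)) != 0 by rewrite toC0'// sqrtr_gt0.
  have sw0 : toC (Num.sqrt (p (idx w) w)) != 0 by rewrite toC0'// sqrtr_gt0.
  have sy2 : toC (Num.sqrt (p (idx y) w)) ^+ 2 = P (idx y) (idx y) w.
    by rewrite pE expr2 -toCM -expr2 sqr_sqrtr// ltW.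
  have sw2 : toC (Num.sqrt (p (idx w) w)) ^+ 2 = P (idx w) (idx w) w.
    by rewrite pE expr2 -toCM -expr2 sqr_sqrtr// ltW.
  have mE : modC (P (idx y) (idx w) w) = Num.sqrt (p (idx y) w) * Num.sqrt (p (idx w) w).
    by rewrite -sqrtrM ?(ltW py0)// -modP2 sqrtr_sqr ger0_norm// modC_ge0.
  have := thE _ _ _ Uyw Uww; rewrite mE toCM => Pyw.
  have := PP j (idx y) (idx y) (idx w); rewrite {1}Pyw -sy2.
  move=> E; rewrite /sect phiyE (turnD (_ + _)) turn_int mulr1 (turnD (phi w w)).
  set S := toC (Num.sqrt (p (idx y) w)) in sy0 sy2 E *.
  set T := toC (Num.sqrt (p (idx w) w)) in sw0 sw2 E *.
  have E' : P j (idx y) w * T * turn (th y w w) = P j (idx w) w * S.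
    apply: (mulfI sy0); rewrite [RHS](_ : _ = P j (idx w) w * S ^+ 2); last by ring.
    rewrite -E. by ring.
  apply: (mulfI (mulf_neq0 sy0 sw0)).
  rewrite [LHS](_ : _ = (P j (idx y) w * T * turn (th y w w)) * turn (phi w w)); last first.
    by field.
  by rewrite E'; field.
(* At every point the section is read in the chart of that point; near [y] it coincides with the
   continuous section in the chart of [y]. *)
exists (fun j w => sect j w w); split.
  move=> j y; apply: (@continuous_near_eq _ _ _ (sect j y)).
    have /open_nbhs_nbhs := cW y; apply: filterS => w yw.
    by rewrite -(sectE _ y).
  have yy : W y y by have [] := cW y.
  have py0 : 0 < p (idx y) y by rewrite (lt_trans eps_gt0)//.
  apply: cvgM; last first.
    apply: (@continuous_comp _ _ _ (phi y) (@turn R)); last exact: turn_cont.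
    exact: cphi.
  apply: cvgM; first exact: cP.
  apply: (@continuousV C _ (fun w => toC (Num.sqrt (p (idx y) w)))).
    by rewrite toC_eq0 gt_eqF// sqrtr_gt0.
  apply: (@continuous_comp _ _ _ (fun w => Num.sqrt (p (idx y) w)) (@toC R)); last exact: toC_cont.
  apply: (@continuous_comp _ _ _ (p (idx y)) Num.sqrt); last exact: sqrt_continuous.
  exact: cp.
move=> i j y; have [PJ PP _ _] := P1 y.
have py0 : 0 < p (idx y) y by rewrite (lt_trans eps_gt0)//.
have sy0 : toC (Num.sqrt (p (idx y) y)) != 0.
  by rewrite toC_eq0 gt_eqF// sqrtr_gt0.
have sy2 : toC (Num.sqrt (p (idx y) y)) ^+ 2 = P (idx y) (idx y) y.
  by rewrite pE expr2 -toCM -expr2 sqr_sqrtr// ltW.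
rewrite /sect !(rmorphM, fmorphV)/= conj_toC -PJ.
set S := toC _ in sy0 sy2 *.
rewrite [RHS](_ : _ = (P i (idx y) y * P (idx y) j y) / S ^+ 2 *
   (turn (phi y y) * (turn (phi y y))^*)); last by field.
by rewrite turn_mul_conj mulr1 PP sy2 mulfK// -sy2 expf_neq0.
Qed.

End RankOne.

(** * Cozero sets *)

Section Cozero.
Variables (R : realType) (M : topologicalType).
Hypotheses (cM : compact [set: M]) (hM : hausdorff_space M).

(** From some index [N] on all terms lie below [e], so up to an error [e] the supremum is governed
    by the first [N] functions. *)
Lemma sup_vanishing_continuous (v : nat -> M -> R) :
  (forall n, continuous (v n)) ->
  (forall n x, 0 <= v n x <= n.+1%:R^-1) ->
  continuous (fun x => sup (range (v^~ x))).
Proof.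
move=> cv v01; set f := fun x => _.
have fub x : has_ubound (range (v^~ x)).
  exists 1 => _ [n _ <-]; have /andP[_ /le_trans] := v01 n x; apply.
  by rewrite invf_le1 ?ltr0n// ler1n.
have f_ge n x : v n x <= f x by apply: ub_le_sup => //; exists n.
have f_le x c : (forall n, v n x <= c) -> f x <= c.
  by move=> H; apply: ge_sup; [exists (v 0 x); exists 0|move=> _ [n _ <-]].
have f_ge0 x : 0 <= f x.
  by apply: le_trans (f_ge 0 x); have /andP[] := v01 0 x.
move=> x; apply/cvgrPdist_le => e e0.
pose N := (Num.truncn e^-1).+1.
have Ne : N%:R^-1 < e.
  have := truncnS_gt e^-1; rewrite -/N => h.
  by rewrite -[ltRHS]invrK ltf_pV2// posrE ?ltr0n// invr_gt0.
have : \forall y \near x, forall n : 'I_N, `|v n x - v n y| <= e.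
  apply: filter_forall => n.
  by have /cvgrPdist_le/(_ _ e0) := cv n x.
apply: filterS => y H.
have key a b : (forall n : 'I_N, `|v n a - v n b| <= e) -> f a <= f b + e.
  move=> Hab; apply: f_le => n; have [nN|Nn] := ltnP n N.
    have := Hab (Ordinal nN); have := f_ge n b; rewrite /= ler_norml; lra.
  have /andP[_ h] := v01 n a.
  apply: (le_trans h); apply: (@le_trans _ _ e); last by rewrite lerDr.
  apply: le_trans (ltW Ne); rewrite lef_pV2 ?posrE ?ltr0n//.
  by rewrite ler_nat ltnW.
have xy := key x y H.
have yx := key y x (fun n => ltac:(rewrite distrC; exact: H)).
by rewrite ler_norml; apply/andP; split; lra.
Qed.

Lemma second_countable_cozero (O : set M) : @second_countable M -> open O ->
  exists f : M -> R, [/\ continuous f, forall x, 0 <= f x &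
    forall x, 0 < f x <-> O x].
Proof.
move=> [B /countable_injP[g gI] [Bo Bb]] oO.
pose good (b : set M) (u : M -> R) := [/\ continuous u, forall x, 0 <= u x <= 1,
  (forall x, ~ O x -> u x = 0) & forall x, b x -> 0 < u x].
have /choice[u uP] : forall n, exists u : M -> R, [/\ continuous u, forall x, 0 <= u x <= 1,
    (forall x, ~ O x -> u x = 0) & forall b, B b -> g b = n -> (exists v, good b v) ->
    forall x, b x -> 0 < u x].
  move=> n.
  have [[b [Bb' gb [v [cv v01 v0 vb]]]]|H] :=
      pselect (exists b, [/\ B b, g b = n & exists v, good b v]).
    exists v; split => // b' Bb'' gb' _ x.
    suff -> : b' = b by exact: vb.
    by apply: gI; rewrite ?inE// gb gb'.
  exists (cst 0); split => //; first by move=> x; exact: cst_continuous.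
    by move=> x; rewrite lexx ler01.
  by move=> b Bb' gb ev; exfalso; apply: H; exists b.
pose v n x := u n x / n.+1%:R.
have n0 n : 0 < (n.+1%:R^-1 : R) by rewrite invr_gt0 ltr0n.
have v01 n x : 0 <= v n x <= n.+1%:R^-1.
  have [_ /(_ x)/andP[u0 u1] _ _] := uP n.
  apply/andP; split; first exact: mulr_ge0 u0 (ltW (n0 n)).
  exact: ler_piMl (ltW (n0 n)) u1.
have fub x : has_ubound (range (v^~ x)).
  exists 1 => _ [n _ <-]; have /andP[_ /le_trans] := v01 n x; apply.
  by rewrite invf_le1 ?ltr0n// ler1n.
have v_le x n : v n x <= sup (range (v^~ x)).
  by apply: ub_le_sup => //; exists n.
have f0 x : 0 <= sup (range (v^~ x)).
  by apply: le_trans (v_le x 0%N); have /andP[] := v01 0%N x.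
exists (fun x => sup (range (v^~ x))); split => //.
  apply: sup_vanishing_continuous => // n x.
  apply: (@continuousM R M (u n) (cst n.+1%:R^-1)); last exact: cst_continuous.
  by have [+ _ _ _] := uP n; exact.
move=> x; split.
  move=> fx; apply: contrapT => nOx; move: fx.
  suff : sup (range (v^~ x)) <= 0 by rewrite leNgt => /negP.
  apply: ge_sup; first by exists (v 0%N x); exists 0%N.
  move=> _ [n _ <-]; have [_ _ /(_ x nOx) un0 _] := uP n.
  by rewrite /v un0 mul0r.
move=> Ox.
have [w [cw w0 wx wO]] := @compact_hausdorff_bump R M x O cM hM (conj oO Ox).
have gw : good [set y | 0 < w y] (fun y => Num.min (w y) 1).
  split.
  - by move=> y; apply: continuous_min; [exact: cw|exact: cst_continuous].
  - by move=> y; rewrite le_min w0 ler01 ge_min lexx orbT.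
  - by move=> y nOy; rewrite (nbhs_singleton (wO y nOy)) min_l.
  - by move=> y /= wy; rewrite lt_min wy ltr01.
have : nbhs x [set y | 0 < w y] by exact: (cvgr_gt _ (cw x)).
move=> /(Bb x)[b [Bb' bx] bw].
have gb : exists v, good b v.
  have [a1 a2 a3 a4] := gw.
  by exists (fun y => Num.min (w y) 1); split => // y /bw/a4.
have [_ _ _ /(_ b Bb' erefl gb x bx) ux] := uP (g b).
by apply: lt_le_trans (v_le x (g b)); rewrite mulr_gt0.
Qed.

End Cozero.

(** * Equivariant functions on the free part *)

Section L2Normalization.
Variables (R : realType) (I : finType).
Local Notation C := (Cplx R).

Definition l2norm (v : I -> C) : R := Num.sqrt (\sum_i modC (v i) ^+ 2).
Definition normalized (v : I -> C) (i : I) : C := v i / toC (l2norm v).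

Lemma l2norm_gt0 (v : I -> C) : (exists i, v i != 0) -> 0 < l2norm v.
Proof.
move=> [i vi]; rewrite sqrtr_gt0 (bigD1 i)//= ltr_pwDl//.
  by rewrite exprn_gt0// modC_gt0.
by apply: sumr_ge0 => j _; rewrite sqr_ge0.
Qed.

Lemma normalized_sum (v : I -> C) : (exists i, v i != 0) ->
  \sum_i normalized v i * (normalized v i)^* = 1.
Proof.
move=> /l2norm_gt0 n0.
rewrite (eq_bigr (fun i => toC (modC (v i) ^+ 2 / l2norm v ^+ 2))); last first.
  move=> i _; rewrite mul_conjE /normalized modCM exprMn toCM toCM; congr (_ * _).
  congr toC.
  rewrite -exprVn; congr (_ ^+ _); apply: toC_inj.
  by rewrite modCE normfV norm_toC ger0_norm ?(ltW n0)// /toC fmorphV.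
rewrite -(rmorph_sum (real_complex R))/= -mulr_suml.
have <- : l2norm v ^+ 2 = \sum_i modC (v i) ^+ 2.
  by rewrite sqr_sqrtr// sumr_ge0// => i _; exact: sqr_ge0.
by rewrite divff// expf_neq0// gt_eqF.
Qed.

Lemma normalized_continuous (X : topologicalType) (v : I -> X -> C) (x : X) (i : I) :
  (exists i, v i x != 0) -> (forall i, {for x, continuous (v i)}) ->
  {for x, continuous (fun y => normalized (v^~ y) i)}.
Proof.
move=> v0 cv; apply: cvgM; first exact: cv.
apply: (@continuousV C _ (fun y => toC (l2norm (v^~ y)))).
  by rewrite toC_eq0 gt_eqF// l2norm_gt0.
apply: (@continuous_comp _ _ _ (fun y => l2norm (v^~ y)) (@toC R)); last exact: toC_cont.
apply: (@continuous_comp _ _ _ (fun y => \sum_i modC (v i y) ^+ 2) Num.sqrt);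
  last exact: sqrt_continuous.
apply: sum_continuous => j; apply: (@continuous_comp _ _ _ (fun y => modC (v j y))
  (fun r : R => r ^+ 2)); last exact: exprn_continuous.
apply: (@continuous_comp _ _ _ (v j) (@modC R)); first exact: cv.
exact: modC_cont.
Qed.

Lemma normalized_scale (w : C) (v : I -> C) i :
  modC w = 1 -> normalized (fun j => w * v j) i = w * normalized v i.
Proof.
move=> w1; rewrite /normalized -mulrA; congr (_ * (_ / toC _)).
by rewrite /l2norm; under eq_bigr do rewrite modCM w1 mul1r.
Qed.

End L2Normalization.

Section Equivariant.
Variables (R : realType) (M : topologicalType) (theta : M -> M) (p : nat).
Hypotheses (cM : compact [set: M]) (hM : hausdorff_space M).
Hypothesis scM : @second_countable M.
Hypotheses (p_prime : prime p) (theta_cont : continuous theta).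
Hypothesis theta_p : iter p theta = id.
Local Notation C := (Cplx R).
Local Notation M0 := (~` fixed_points theta).

Let p_gt0 : (0 < p)%N. Proof. exact: prime_gt0. Qed.

Lemma iter_mulp k x : iter (k * p) theta x = x.
Proof.
elim: k => // k IH; rewrite mulSn iterD IH.
by move/(congr1 (@^~ x)): theta_p.
Qed.

Lemma iter_modp k x : iter (k %% p) theta x = iter k theta x.
Proof. by rewrite [in RHS](divn_eq k p) addnC iterD iter_mulp. Qed.

Lemma theta_inj : injective theta.
Proof.
move=> x y xy; rewrite -(iter_mulp 1 x) -(iter_mulp 1 y) mul1n.
by rewrite -(prednK p_gt0) !iterSr xy.
Qed.

(** Here primality makes the action free on M_0: by Bezout [theta] is an iterate of [iter k theta],
    so a point fixed by the latter is fixed by [theta]. *)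
Lemma free_iter x k : M0 x -> (0 < k < p)%N -> iter k theta x <> x.
Proof.
move=> Mx /andP[k0 kp] kx; apply: Mx.
have [km kn e _] := egcdnP p k0.
have g1 : gcdn k p = 1%N.
  apply/eqP; rewrite -/(coprime k p) coprime_sym prime_coprime//.
  by apply/negP => /(dvdn_leq k0); rewrite leqNgt kp.
have kmx m : iter (m * k) theta x = x.
  by elim: m => // m IH; rewrite mulSn iterD IH.
by have := kmx km; rewrite e g1 addn1 iterS iter_mulp.
Qed.

Lemma free_theta x : M0 x -> M0 (theta x).
Proof. by move=> Mx tx; apply: Mx; apply: theta_inj. Qed.

Lemma free_iterM k x : M0 x -> M0 (iter k theta x).
Proof. by move=> Mx; elim: k => // k IH; exact: free_theta. Qed.

Let cit k : continuous (iter k theta).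
Proof. exact: iter_continuous. Qed.

Lemma free_neighborhood x : M0 x -> exists O : set M,
  open_nbhs x O /\ forall k, (0 < k < p)%N -> forall y, O y -> ~ O (iter k theta y).
Proof.
move=> Mx.
have sep (k : 'I_p) : exists O : set M, nbhs x O /\ ((0 < k)%N ->
    forall y, O y -> ~ O (iter k theta y)).
  have [k0|k0] := posnP k; first by exists setT; split => //; exact: filterT.
  have kx : x != iter k theta x.
    by apply/eqP => e; apply: (@free_iter x k Mx); rewrite ?k0/=.
  have := hM; rewrite open_hausdorff => /(_ _ _ kx)[[A B]/= [/set_mem Ax /set_mem Bx] [oA oB AB]].
  exists (A `&` iter k theta @^-1` B); split.
    apply: filterI; first exact: open_nbhs_nbhs.
    exact: (@cit k x B (open_nbhs_nbhs (conj oB Bx))).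
  move=> _ y [_ By] [Ay _]; move/eqP/seteqP: AB => [AB _].
  exact: (AB _ (conj Ay By)).
have [Ok OkP] := boolp.choice sep.
have : nbhs x [set y | forall k, Ok k y].
  by apply: filter_forall => k; have [] := OkP k.
rewrite nbhsE => -[Q [oO Ox] OO]; exists Q; split => // k /andP[k0 kp] y Oy Oky.
by have [_ /(_ k0 y)] := OkP (Ordinal kp); apply; exact: OO.
Qed.

Lemma free_open : open M0.
Proof.
rewrite openE => x Mx; rewrite /interior/=.
have x0 : x != theta x by apply/eqP => e; apply: Mx.
have := hM; rewrite open_hausdorff => /(_ _ _ x0)[[A B]/= [/set_mem Ax /set_mem Bx] [oA oB AB]].
have : nbhs x (A `&` theta @^-1` B).
  apply: filterI; first exact: open_nbhs_nbhs.
  exact: (@theta_cont x B (open_nbhs_nbhs (conj oB Bx))).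
apply: filterS => y [Ay By] ty; move/eqP/seteqP: AB => [AB _].
by apply: (AB y); split => //; rewrite -ty.
Qed.

(* Plays the role of the distance to the fixed points. *)
Lemma invariant_gauge : exists d : M -> R,
  [/\ continuous d, forall x, 0 <= d x, forall x, 0 < d x <-> M0 x &
      forall x, d (theta x) = d x].
Proof.
have [f [cf f0 fM]] := @second_countable_cozero R M cM hM _ scM free_open.
exists (fun x => \sum_(k < p) f (iter k theta x)); split.
- move=> x; apply: sum_continuous => k.
  by apply: (@continuous_comp _ _ _ (iter k theta) f); [exact: cit|exact: cf].
- by move=> x; apply: sumr_ge0.
- move=> x; split.
    move=> + xx; rewrite big1 ?ltxx// => k _; apply/eqP; rewrite eq_le f0 andbT leNgt.
    apply/negP => /fM; apply.
    have -> : iter k theta x = x by elim: (k : nat) => // m; rewrite iterS => ->.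
    exact: xx.
  move=> Mx; rewrite (bigD1 (Ordinal p_gt0))//= ltr_pwDl//; first exact/fM.
  by apply: sumr_ge0.
- move=> x; under eq_bigr do rewrite -iterSr.
  rewrite -(big_mkord xpredT (fun k => f (iter k.+1 theta x))).
  rewrite -(big_mkord xpredT (fun k => f (iter k theta x))).
  rewrite -(prednK p_gt0) big_nat_recr// [RHS]big_nat_recl//= addrC; congr (_ + _).
  by rewrite -iterS (prednK p_gt0) theta_p.
Qed.

End Equivariant.

(** * Averaging over the cyclic group, and merging many equivariant functions into few *)

Section FiniteType.
Variables (R : realType) (M : topologicalType) (theta : M -> M) (p : nat).
Hypotheses (p_prime : prime p) (theta_cont : continuous theta).
Hypothesis theta_p : iter p theta = id.
Local Notation C := (Cplx R).
Local Notation M0 := (~` fixed_points theta).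
Variables (w : C).
Hypotheses (w_p : w ^+ p = 1) (w_unit : w * w^* = 1).

Let p_gt0 : (0 < p)%N. Proof. exact: prime_gt0. Qed.

Let w_mod : modC w = 1. Proof. exact: unit_modC. Qed.

Definition equivariant (h : M -> C) := forall x, h (theta x) = w * h x.

(** Up to the factor [p], the spectral projection of [f] onto the eigenfunctions with eigenvalue
    [w]. *)
Definition equivariant_average (f : M -> R) (x : M) : C :=
  \sum_(0 <= k < p) w^* ^+ k * toC (f (iter k theta x)).

Lemma equivariant_averageP (f : M -> R) : equivariant (equivariant_average f).
Proof.
move=> x; rewrite /equivariant_average -(prednK p_gt0).
rewrite big_nat_recr//= [in RHS]big_nat_recl//= expr0 mul1r mulrDr addrC; congr (_ + _).
  rewrite -iterSr (prednK p_gt0) theta_p; congr (_ * _).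
  have : (w * w^*) ^+ p = 1 by rewrite w_unit expr1n.
  rewrite exprMn w_p mul1r => wp.
  by rewrite -[LHS]mul1r -w_unit -mulrA -exprS (prednK p_gt0) wp mulr1.
rewrite mulr_sumr; apply: eq_bigr => k _.
by rewrite exprS !mulrA w_unit mul1r -iterSr iterS.
Qed.

Lemma equivariant_average_continuous (f : M -> R) :
  continuous f -> continuous (equivariant_average f).
Proof.
move=> cf x; apply: sum_continuous => k; apply: cvgM; first exact: cvg_cst.
apply: (@continuous_comp _ _ _ (f \o iter k theta) (@toC R)); last exact: toC_cont.
by apply: continuous_comp; [exact: iter_continuous|exact: cf].
Qed.

(* At most one term of the average is nonzero. *)
Lemma equivariant_average_neq0 (f : M -> R) (B : set M) x :
  (forall x, 0 < f x <-> B x) -> (forall x, 0 <= f x) ->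
  (forall k, (0 < k < p)%N -> forall y, B y -> ~ B (iter k theta y)) ->
  equivariant_average f x != 0 <-> exists2 k, (k < p)%N & B (iter k theta x).
Proof.
move=> fB f0 sB; split.
  move=> H; apply: contrapT => nB; move: H; apply/negP; rewrite negbK.
  apply/eqP; rewrite /equivariant_average big_nat_cond big1// => k; rewrite andbT => /andP[_ kp].
  suff -> : f (iter k theta x) = 0 by rewrite mulr0.
  apply/eqP; rewrite eq_le f0 andbT leNgt; apply/negP => /fB Bk.
  by apply: nB; exists k.
move=> [k kp Bk]; rewrite /equivariant_average.
rewrite (bigD1_seq k) ?iota_uniq ?mem_index_iota//= big_nat_cond big1.
  rewrite addr0 mulf_neq0// ?expf_neq0//.
    by rewrite conjC_eq0 -modC_gt0 w_mod.
  by rewrite toC_eq0 gt_eqF//; apply/fB.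
move=> m /andP[/= mp mk].
suff -> : f (iter m theta x) = 0 by rewrite mulr0.
apply/eqP; rewrite eq_le f0 andbT leNgt; apply/negP => /fB Bm.
case: (ltngtP m k) => km.
- apply: (sB (k - m)%N _ _ Bm).
    by rewrite subn_gt0 km (leq_ltn_trans _ kp)// leq_subr.
  by rewrite -iterD subnK// ltnW.
- apply: (sB (m - k)%N _ _ Bk).
    by rewrite subn_gt0 km (leq_ltn_trans _ mp)// leq_subr.
  by rewrite -iterD subnK// ltnW.
- by rewrite km eqxx in mk.
Qed.

Section Combine.
Variables (J : finType) (f : J -> M -> C).
Hypotheses (cf : forall j, continuous (f j)) (ef : forall j, equivariant (f j)).

(* If exactly [k] of the [f j x] are nonzero, a single term of the sum survives. *)
Definition combine (k : nat) (x : M) : C :=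
  \sum_(S : {set J} | #|S| == k)
    (\prod_(j in S) toC (modC (f j x))) * (if [pick j in S] is Some j then f j x else 0).

Lemma combine_continuous k : continuous (combine k).
Proof.
move=> x; rewrite /combine (_ : (fun x => _) = (fun x => \sum_(S : {set J})
   if #|S| == k then (\prod_(j in S) toC (modC (f j x))) *
   (if [pick j in S] is Some j then f j x else 0) else 0)); last first.
  by apply/funext => y; rewrite big_mkcond.
apply: sum_continuous => S; rewrite /prop_for; case: (#|S| == k); last exact: cst_continuous.
apply: cvgM; last first.
  by case: pickP => [j _|_]; [exact: cf|exact: cst_continuous].
apply: cvg_big; first exact: mul_continuous.
move=> j _; apply: (@continuous_comp _ _ _ (@modC R \o f j) (@toC R)); last exact: toC_cont.
by apply: continuous_comp; [exact: cf|exact: modC_cont].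
Qed.

(** The moduli are invariant, and the single picked [f j] carries the factor [w]. *)
Lemma combine_equivariant k : equivariant (combine k).
Proof.
move=> x; rewrite /combine mulr_sumr; apply: eq_bigr => S _.
rewrite mulrCA; congr (_ * _).
  by apply: eq_bigr => j _; rewrite ef modCM w_mod mul1r.
by case: pickP => [j _|_]; rewrite ?ef ?mulr0.
Qed.

Lemma combine_neq0 x : (exists j, f j x != 0) ->
  combine #|[set j | f j x != 0]%SET| x != 0.
Proof.
move=> [i fi]; set S0 := [set j | f j x != 0]%SET.
rewrite /combine (bigD1 S0)//= [X in _ + X]big1.
  rewrite addr0 mulf_neq0//.
    rewrite prodf_seq_neq0; apply/allP => j _; apply/implyP.
    by rewrite inE toC_eq0 modC_eq0.
  case: pickP => [j|/(_ i)]; first by rewrite inE.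
  by rewrite !inE fi.
move=> S /andP[/eqP cS SS].
have /subsetPn[j jS jS0] : ~~ (S \subset S0).
  apply: contra SS => sub; rewrite eqEcard sub/= cS//.
have fj : f j x = 0 by apply/eqP; move: jS0; rewrite inE negbK.
rewrite (bigD1 j)//= (_ : toC (modC (f j x)) = 0) ?mul0r//.
by apply/eqP; rewrite toC_eq0 modC_eq0 fj.
Qed.

End Combine.
End FiniteType.

(** * Equivariant functions without common zero over compact parts of M_0 *)

Section FiniteTypeCompact.
Variables (R : realType) (M : topologicalType) (theta : M -> M) (p : nat).
Hypotheses (cM : compact [set: M]) (hM : hausdorff_space M).
Hypothesis scM : @second_countable M.
Hypotheses (p_prime : prime p) (theta_cont : continuous theta).
Hypothesis theta_p : iter p theta = id.
Local Notation C := (Cplx R).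
Local Notation M0 := (~` fixed_points theta).
Variables (w : C).
Hypotheses (w_p : w ^+ p = 1) (w_unit : w * w^* = 1).
Hypothesis dimM : covering_dim_le M 2.
Variable d : M -> R.
Hypotheses (cd : continuous d) (dM0 : forall x, 0 < d x <-> M0 x).

Lemma card_le_indices (F : {fset set M}) (T : {set F}) (A : set (set M)) (n : nat) :
  (A #<= `I_n.+1)%card -> (forall j, j \in T -> A (val j)) -> (#|T| <= n.+1)%N.
Proof.
move=> An TA; have fA : finite_set A by apply/finite_set_leP; exists n.+1.
rewrite cardE -(size_map val); apply: leq_trans (geq_card_fset_set An).
apply: uniq_leq_size; first by rewrite map_inj_uniq ?enum_uniq//; exact: val_inj.
move=> _ /mapP[j jT ->]; rewrite in_fset_set// inE; apply: TA.
by rewrite mem_enum in jT.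
Qed.

(* By the dimension bound at most [p * 3] of the equivariant functions attached to
   a cover are nonzero at any point, so the number of [h k] is independent of [eps]. *)
Lemma finite_type_compact (eps : R) : 0 < eps ->
  exists h : 'I_(p * 3).+1 -> M -> C,
    [/\ forall k, continuous (h k), forall k, equivariant theta w (h k) &
      forall x, eps <= d x -> exists k, h k x != 0].
Proof.
move=> eps0.
pose small (A : set M) := open A /\
  forall k, (0 < k < p)%N -> forall y, A y -> ~ A (iter k theta y).
have small0 : small set0 by split => //; exact: open0.
have /boolp.choice[nb nbP] : forall x, exists A, small A /\ (M0 x -> A x).
  move=> x; have [Mx|nMx] := pselect (M0 x); last by exists set0.
  have [A [[oA Ax] sA]] := @free_neighborhood M theta p hM p_prime theta_cont theta_p x Mx.
  by exists A.
have cK : compact [set x | eps <= d x].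
  apply: (@subclosed_compact _ _ [set: M]) => //.
  apply: (@preimage_closed _ _ d [set y | eps <= y]); last exact: closed_ge.
  by move=> x _; exact: cd.
have [x Kx|s sP] := @compact_finite_cover _ _ nb cK.
  have [[onb _] /(_ _)nbx] := nbP x.
  by apply: open_nbhs_nbhs; split => //; apply: nbx; apply/dM0; exact: lt_le_trans Kx.
pose D := [set x | d x < eps].
have oD : open D.
  apply: (@open_comp _ _ d [set y | y < eps]); last exact: open_lt.
  by move=> x _; exact: cd.
have [|V [[fV oV VT] VU V3]] := dimM (U := [set` D :: map nb s]).
  split.
  - by apply/finite_seqP; exists (D :: map nb s).
  - move=> A /=; rewrite inE => /orP[/eqP ->//|/mapP[y _ ->]].
    by have [[]] := nbP y.
  - apply/seteqP; split => // x _.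
    have [xD|xD] := ltP (d x) eps; first by exists D => //=; rewrite inE eqxx.
    have [y ys xy] := sP x xD; exists (nb y) => //=.
    by rewrite inE map_f// orbT.
pose F := fset_set V.
have FV (j : F) : V (val j).
  by have := valP j; rewrite in_fset_set// inE.
(* Members of the refinement that lie only in [D] may meet their own translates; they are replaced
   by the empty set. Nothing is lost where [eps <= d x]: a member containing such an [x] is not
   inside [D], hence is inside some [nb y]. *)
pose W (j : F) : set M := if pselect (small (val j)) then val j else set0.
have sW j : small (W j) by rewrite /W; case: (pselect (small (val j))).
have Wj j : W j `<=` val j.
  by rewrite /W; case: (pselect (small (val j))) => sj x //=; case.
have /boolp.choice[rho rhoP] : forall j : F, exists f : M -> R,
    [/\ continuous f, forall x, 0 <= f x & forall x, 0 < f x <-> W j x].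
  by move=> j; apply: second_countable_cozero => //; have [] := sW j.
pose f (j : F) := equivariant_average theta p w (rho j).
have cf j : continuous (f j).
  by apply: equivariant_average_continuous => //; have [] := rhoP j.
have ef j : equivariant theta w (f j) by exact: equivariant_averageP.
have fP j x : f j x != 0 <-> exists2 k, (k < p)%N & W j (iter k theta x).
  have [_ r0 rW] := rhoP j; have [_ sj] := sW j.
  exact: equivariant_average_neq0.
(* [f j x] is nonzero only if one of the [p] points [iter k theta x] lies in [W j], and dimension 2
   allows at most three members of the cover at each of them. *)
have f3 x : (#|[set j | (f j x != 0)%R]%SET| < (p * 3).+1)%N.
  rewrite ltnS; pose T (k : 'I_p) := [set j : F | `[< val j (iter k theta x) >] ]%SET.
  apply: (@leq_trans (\sum_(k < p) #|T k|)%N); last first.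
    rewrite -[X in (_ <= X * 3)%N]card_ord -sum_nat_const; apply: leq_sum => k _.
    apply: (card_le_indices (V3 (iter k theta x))) => j.
    by rewrite inE => /asboolP; split.
  rewrite -sum1_card (eq_bigr (fun k : 'I_p => \sum_(j : F) (j \in T k : nat))%N); last first.
    by move=> k _; rewrite -sum1_card [LHS]big_mkcond/=; apply: eq_bigr => j _; case: (j \in T k).
  rewrite exchange_big/= [X in (X <= _)%N]big_mkcond/=; apply: leq_sum => j _.
  rewrite inE; case: ifPn => // /fP[k kp Wk].
  rewrite (bigD1 (Ordinal kp))//= inE (_ : `[< _ >] = true) ?add1n//.
  by apply/asboolP; exact: Wj.
exists (fun k => combine f k); split.
- by move=> k; exact: combine_continuous.
- by move=> k; apply: combine_equivariant.
- move=> x ex; have [B VB Bx] : exists2 B, V B & B x.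
    by have : [set: M] x by []; rewrite -VT => -[B VB Bx]; exists B.
  have BF : B \in F by rewrite in_fset_set// inE.
  pose j : F := [` BF]%fset.
  have sB : small B.
    have [A /= + BA] := VU B VB; rewrite inE => /orP[/eqP AD|/mapP[y _ Ay]].
      by have := BA _ Bx; rewrite AD /D /= ltNge ex.
    split; first exact: oV.
    have [[_ snb] _] := nbP y; rewrite -Ay in snb.
    by move=> k kp z /BA Az /BA; exact: snb.
  have fj : f j x != 0.
    by apply/fP; exists 0%N; [exact: prime_gt0|rewrite /W; case: pselect].
  exists (Ordinal (f3 x)); apply: combine_neq0; by exists j.
Qed.

End FiniteTypeCompact.

(** * Equivariant functions without common zero over all of M_0 *)

Section FiniteTypeFree.
Variables (R : realType) (M : topologicalType) (theta : M -> M) (p : nat).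
Hypotheses (cM : compact [set: M]) (hM : hausdorff_space M).
Hypothesis scM : @second_countable M.
Hypotheses (p_prime : prime p) (theta_cont : continuous theta).
Hypothesis theta_p : iter p theta = id.
Local Notation C := (Cplx R).
Local Notation M0 := (~` fixed_points theta).
Variables (w : C).
Hypotheses (w_p : w ^+ p = 1) (w_unit : w * w^* = 1).
Hypothesis dimM : covering_dim_le M 2.
Variable d : M -> R.
Hypotheses (cd : continuous d) (dM0 : forall x, 0 < d x <-> M0 x).
Hypothesis d_theta : forall x, d (theta x) = d x.

Let tent (n : nat) (t : R) : R := Num.max 0 (1 - `|t - n%:R|).

Let tent_cont n : continuous (tent n).
Proof.
move=> t.
suff : {for t, continuous ((cst 0 : R -> R^o) \max (fun t : R => 1 - `|t - n%:R| : R^o))} by [].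
apply: continuous_max; first exact: cst_continuous.
apply: cvgB; first exact: cvg_cst.
by apply: cvg_norm; apply: cvgB; [exact: cvg_id|exact: cvg_cst].
Qed.

Let tent0 n t : 1 <= `|t - n%:R| -> tent n t = 0.
Proof. by move=> h; rewrite /tent max_l// subr_le0. Qed.

Let gate (b : bool) (n : nat) (t : R) := if odd n == b then tent n t else 0.

Let gate_cont b n : continuous (gate b n).
Proof. by rewrite /gate; case: (odd n == b); [exact: tent_cont|exact: cst_continuous]. Qed.

Let gate0 b n t : t + 1 <= n%:R -> gate b n t = 0.
Proof.
move=> h; rewrite /gate; case: ifP => // _; apply: tent0.
by rewrite ler0_norm ?opprB; lra.
Qed.

(* Tents centered at integers of the same parity have disjoint supports, so at each
   point one of the two sums below reduces to a nonzero multiple of a single [h n]. *)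
Section Glue.
Variable h : nat -> M -> C.
Hypotheses (ch : forall n, continuous (h n)) (eh : forall n, equivariant theta w (h n)).

Let partial b N x : C := \sum_(0 <= n < N) toC (gate b n (d x)^-1) * h n x.

(** Tents centred at [t + 1] or beyond vanish at [t], and [t] is less than its truncation plus 1;
    hence the bound [.+2], beyond which further terms change nothing. Locally the sum thus has a
    fixed number of terms. *)
Let glue b x : C := partial b (Num.truncn (d x)^-1).+2 x.

Let partial_le b N N' x : (N <= N')%N -> (d x)^-1 + 1 <= N%:R ->
  partial b N' x = partial b N x.
Proof.
move=> NN' xN; rewrite /partial (big_cat_nat_idem _ _ NN')//= ?addr0//.
rewrite [X in _ + X]big_nat_cond [X in _ + X]big1 ?addr0//.
move=> n; rewrite andbT => /andP[Nn _].
by rewrite gate0 ?toC0 ?mul0r// (le_trans xN)// ler_nat.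
Qed.

Let partial_glue b N x : (d x)^-1 + 1 <= N%:R -> glue b x = partial b N x.
Proof.
move=> xN.
have xT : (d x)^-1 + 1 <= (Num.truncn (d x)^-1).+2%:R.
  by rewrite -[in leRHS]natr1 lerD2r ltW// truncnS_gt.
rewrite /glue; have [le|/ltnW le] := leqP N (Num.truncn (d x)^-1).+2.
  exact: partial_le.
by apply/esym/partial_le.
Qed.

Let glue_cont b x : M0 x -> {for x, continuous (glue b)}.
Proof.
move=> /dM0 dx; pose N := (Num.truncn (d x)^-1).+3.
have cdV : {for x, continuous (fun y => (d y)^-1)}.
  by apply: continuousV; [rewrite gt_eqF|exact: cd].
apply: (@continuous_near_eq _ _ _ (partial b N)).
  have xN : (d x)^-1 + 1 < N%:R.
    rewrite /N -[in ltRHS]natr1 ltrD2r (lt_trans (truncnS_gt _))//.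
    by rewrite ltr_nat.
  rewrite -ltrBrDr in xN.
  have /(cvgr_lt _) := cdV.
  move=> /(_ _ xN); apply: filterS => y yN; apply: partial_glue.
  by rewrite -lerBrDr ltW.
apply: sum_continuous => n; apply: cvgM; last exact: ch.
apply: (@continuous_comp _ _ _ (fun y => gate b n (d y)^-1) (@toC R)); last exact: toC_cont.
by apply: (@continuous_comp _ _ _ (fun y => (d y)^-1) (gate b n)); last exact: gate_cont.
Qed.

Let glue_equiv b x : glue b (theta x) = w * glue b x.
Proof.
rewrite /glue /partial d_theta mulr_sumr; apply: eq_bigr => n _.
by rewrite eh mulrCA.
Qed.

Let glueE x : M0 x -> let n := Num.truncn (d x)^-1 in
  exists2 c : C, c != 0 & glue (odd n) x = c * h n x.
Proof.
move=> /dM0 dx n; have t0 : 0 <= (d x)^-1 by rewrite ltW// invr_gt0.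
have /andP[t1 t2] := truncn_itv t0; rewrite -/n in t1 t2.
exists (toC (tent n (d x)^-1)).
  rewrite toC_eq0 gt_eqF// lt_max; apply/orP; right.
  by rewrite subr_gt0 ger0_norm ?subr_ge0// ltrBlDl natr1.
rewrite /glue /partial -/n (bigD1_seq n) ?iota_uniq ?mem_index_iota ?leqnSn//=.
rewrite big1 ?addr0; first by rewrite /gate eqxx.
move=> m mn; rewrite /gate; case: eqP => [om|_]; last by rewrite toC0 mul0r.
rewrite tent0 ?toC0 ?mul0r//.
case: (ltngtP m n) => nm; last by rewrite nm eqxx in mn.
  have : (m.+2 <= n)%N.
    rewrite ltn_neqAle nm andbT; apply/eqP => e.
    by move: om; rewrite -e/=; case: (odd m).
  rewrite -(ler_nat R) -2!natr1 => h1.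
  by rewrite ger0_norm; lra.
have : (n.+2 <= m)%N.
  rewrite ltn_neqAle nm andbT; apply/eqP => e.
  by move: om; rewrite -e/=; case: (odd n).
rewrite -(ler_nat R) -2!natr1 => h1.
rewrite -natr1 in t2.
by rewrite ler0_norm; lra.
Qed.

Lemma parity_gluing : exists g : bool -> M -> C,
  [/\ forall b x, M0 x -> {for x, continuous (g b)},
      forall b, equivariant theta w (g b) &
      forall x, M0 x -> let n := Num.truncn (d x)^-1 in
        exists2 c : C, c != 0 & g (odd n) x = c * h n x].
Proof. by exists glue. Qed.

End Glue.

(** The family [h n] has no common zero where [d x >= 1/(n+1)], in particular where 1/d has
    truncation [n]; there the gluing of parity [odd n] is a nonzero multiple of [h n]. Gluing by
    parity only doubles the size of the index set. *)
Lemma finite_type_free : exists (I : finType) (H : I -> M -> C),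
  [/\ forall i x, M0 x -> {for x, continuous (H i)},
      forall i, equivariant theta w (H i) &
      forall x, M0 x -> \sum_i H i x * (H i x)^* = 1].
Proof.
have H n : exists h : 'I_(p * 3).+1 -> M -> C,
    [/\ forall k, continuous (h k), forall k, equivariant theta w (h k) &
      forall x, n.+1%:R^-1 <= d x -> exists k, h k x != 0].
  by apply: finite_type_compact => //; rewrite invr_gt0 ltr0n.
have [h hP] := boolp.choice H.
have ch k n : continuous (h n k) by have [] := hP n.
have eh k n : equivariant theta w (h n k) by have [] := hP n.
have [g gP] := boolp.choice (fun k => @parity_gluing _ (ch k) (eh k)).
pose v (i : bool * 'I_(p * 3).+1) := g i.2 i.1.
have v_neq0 x : M0 x -> exists i, v i x != 0.
  move=> Mx; have dx := Mx; move/dM0 in dx.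
  have t0 : 0 <= (d x)^-1 by rewrite ltW// invr_gt0.
  have /andP[_ t2] := truncn_itv t0.
  set n := Num.truncn _ in t2.
  have [_ _ /(_ x)] := hP n; case=> [|k hk].
    by rewrite -[leRHS]invrK lef_pV2 ?posrE ?invr_gt0// ltW.
  exists (odd n, k); have [_ _ /(_ x Mx) [c c0]] := gP k; rewrite -/n /v/= => ->.
  by rewrite mulf_neq0.
exists (bool * 'I_(p * 3).+1)%type, (fun i x => normalized (v^~ x) i); split.
- move=> i x Mx; apply: normalized_continuous; first exact: v_neq0.
  by move=> j; have [+ _ _] := gP j.2; exact.
- move=> i x; rewrite -normalized_scale ?(unit_modC w_unit)//.
  congr (normalized _ _); apply/funext => j.
  by have [_ + _] := gP j.2; exact.
- by move=> x Mx; apply: normalized_sum; exact: v_neq0.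
Qed.

End FiniteTypeFree.

(** * The orbit space *)

Lemma initial_continuous_at (Z T : topologicalType) (A : set T) (f : Z -> A) (z : Z) :
  {for z, continuous (set_val \o f)} -> {for z, continuous f}.
Proof.
move=> cf U [/= _ [[V oV <-] /= Vz VU]].
have : nbhs z ((set_val \o f) @^-1` V) by apply: cf; exact: open_nbhs_nbhs.
by apply: filterS => y Vy; apply: VU.
Qed.

Lemma set_val_continuous (T : topologicalType) (A : set T) :
  continuous (set_val : A -> T).
Proof. exact: initial_continuous. Qed.

Lemma separated_hausdorff (R : realType) (T : topologicalType) :
  (forall x y : T, x <> y -> exists f : T -> R, continuous f /\ f x <> f y) ->
  hausdorff_space T.
Proof.
move=> H x y xy; apply: contrapT => /H[f [cf]]; apply.
apply: (@Rhausdorff R) => U V Ux Vy.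
have [z [Uz Vz]] := xy _ _ (cf x U Ux) (cf y V Vy).
by exists (f z).
Qed.

Section OrbitSpace.
Variables (R : realType) (M : topologicalType) (theta : M -> M) (p : nat).
Hypotheses (cM : compact [set: M]) (hM : hausdorff_space M).
Hypotheses (p_prime : prime p) (theta_cont : continuous theta).
Hypothesis theta_p : iter p theta = id.
Local Notation M0 := (~` fixed_points theta).
Local Notation X := (free_orbit_space theta).
Local Notation piM := (orbit_proj theta).

Let p_gt0 : (0 < p)%N. Proof. exact: prime_gt0. Qed.

Lemma orbit_projP x y : piM x = piM y <-> exists k, y = iter k theta x.
Proof.
split.
  move=> /eqquotP.
  move=> /asboolP[m [n e]]; exists (n * p.-1 + m)%N.
  rewrite iterD e -iterD addnC -[X in (X + _)%N]muln1 -mulnDr add1n (prednK p_gt0).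
  by rewrite (iter_mulp theta_p).
move=> [k ->].
apply/eqquotP.
by apply/asboolP; exists k, 0%N.
Qed.

Lemma orbit_proj_continuous : continuous piM.
Proof. exact: pi_continuous. Qed.

Lemma orbit_proj_theta x : piM (theta x) = piM x.
Proof. by apply/esym/orbit_projP; exists 1%N. Qed.

Lemma orbit_proj_surj y : exists x, piM x = y.
Proof. by exists (repr y); exact: reprK. Qed.

Lemma orbit_proj_open (U : set M) : open U -> open (piM @` U).
Proof.
move=> oU; rewrite /open/= /quotient_open.
rewrite (_ : _ @^-1` _ = \bigcup_k (iter k theta @^-1` U)).
  apply: bigcup_open => k _; apply: open_comp => // x _.
  exact: iter_continuous.
apply/seteqP; split => y /=.
  by move=> [x Ux /esym/orbit_projP[k xk]]; exists k => //=; rewrite -xk.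
move=> [k _ /= Uk]; exists (iter k theta y) => //.
by apply/esym/orbit_projP; exists k.
Qed.

Lemma invariant_iter (T : Type) (f : M -> T) x k :
  M0 x -> (forall x, M0 x -> f (theta x) = f x) -> f (iter k theta x) = f x.
Proof.
move=> Mx ft; elim: k => // k IH; rewrite iterS ft//.
exact: (free_iterM p_prime theta_p).
Qed.

Lemma free_orbit_mem x : M0 x -> piM x \in (piM @` M0).
Proof. by move=> Mx; rewrite inE; exists x. Qed.

Hypothesis M0_neq0 : M0 !=set0.

(** Total on [M] to avoid carrying membership proofs; the value at fixed points is a dummy free
    orbit, supplied by [M0_neq0]. *)
Definition free_proj (x : M) : X :=
  if pselect (M0 x) is left Mx then SigSub (free_orbit_mem Mx)
  else SigSub (free_orbit_mem (projT2 (cid M0_neq0))).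

Lemma free_projE x : M0 x -> set_val (free_proj x) = piM x.
Proof. by move=> Mx; rewrite /free_proj; case: pselect. Qed.

Lemma free_projP x y : M0 x -> M0 y ->
  free_proj x = free_proj y <-> exists k, y = iter k theta x.
Proof.
move=> Mx My; rewrite -orbit_projP -(free_projE Mx) -(free_projE My); split => [-> //|].
exact: val_inj.
Qed.

Lemma free_proj_theta x : M0 x -> free_proj (theta x) = free_proj x.
Proof.
move=> Mx; apply/esym/free_projP => //; last by exists 1%N.
exact: (free_theta p_prime theta_p).
Qed.

Lemma free_proj_surj y : exists2 x, M0 x & free_proj x = y.
Proof.
have : set_val y \in piM @` M0 by exact: valP.
rewrite inE => -[x Mx xy]; exists x => //.
by apply: val_inj; rewrite -[LHS]/(set_val _) free_projE.
Qed.

Lemma free_proj_continuous x : M0 x -> {for x, continuous free_proj}.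
Proof.
move=> Mx; apply: initial_continuous_at.
apply: (@continuous_near_eq _ _ _ piM); last exact: orbit_proj_continuous.
have oM0 := free_open hM theta_cont.
have : nbhs x M0 by exact: open_nbhs_nbhs.
by apply: filterS => y My; rewrite /comp free_projE.
Qed.

(** The set-theoretic section [s] is an arbitrary choice; continuity of [f \o s] comes from
    invariance of [f] and openness of the orbit projection. *)
Lemma free_descend (Z : topologicalType) (f : M -> Z) :
  (forall x, M0 x -> {for x, continuous f}) ->
  (forall x, M0 x -> f (theta x) = f x) ->
  exists2 g : X -> Z, continuous g & forall x, M0 x -> g (free_proj x) = f x.
Proof.
move=> cf ft; have /boolp.choice[s sP] : forall y, exists x, M0 x /\ free_proj x = y.
  by move=> y; have [x Mx xy] := free_proj_surj y; exists x.
have gE x : M0 x -> f (s (free_proj x)) = f x.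
  move=> Mx; have [Ms sx] := sP (free_proj x).
  have /free_projP[//|//|k xk] := sx.
  by rewrite [in RHS]xk invariant_iter.
exists (f \o s) => // y; have [x Mx <-] := free_proj_surj y.
move=> N; rewrite /= gE// => Nx.
have oM0 := free_open hM theta_cont.
have : nbhs x (M0 `&` f @^-1` N).
  by apply: filterI; [exact: open_nbhs_nbhs|exact: cf].
rewrite nbhsE => -[U [oU Ux] UN]; rewrite nbhs_simpl.
exists (set_val @^-1` (piM @` U)); split => /=.
- by exists (piM @` U) => //; exact: orbit_proj_open.
- by exists x => //; rewrite free_projE.
- move=> z [u Uu uz]; have [Mu Nu] := UN u Uu.
  have -> : z = free_proj u by apply: val_inj; rewrite -[RHS]/(set_val _) free_projE.
  by rewrite /= gE.
Qed.

(** A bump at [x] vanishing on the whole orbit of [y], summed along orbits, descends to a continuous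
    function that separates the two orbits. *)
Lemma free_orbit_hausdorff : hausdorff_space X.
Proof.
apply: (@separated_hausdorff R) => a b.
have [x Mx <-] := free_proj_surj a; have [y My <-] := free_proj_surj b => xy.
pose W := [set z | forall k : 'I_p, z <> iter k theta y].
have Wx : open_nbhs x W.
  split.
    rewrite openE => z Wz; rewrite /interior/=; apply: filter_forall => k.
    apply: open_nbhs_nbhs; split; last exact: Wz.
    have /closed_openC : closed [set iter k theta y].
      exact/accessible_closed_set1/hausdorff_accessible.
    exact.
  move=> k xk; apply: xy; apply/esym/free_projP => //.
  by exists k.
have [u [cu u0 ux uW]] := @compact_hausdorff_bump R M x W cM hM Wx.
pose F z := \sum_(0 <= k < p) u (iter k theta z).
have cF : continuous F.
  move=> z; apply: sum_continuous => k.
  by apply: (@continuous_comp _ _ _ (iter k theta) u); [exact: iter_continuous|exact: cu].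
have Ft z : F (theta z) = F z.
  rewrite /F; under eq_bigr do rewrite -iterSr.
  rewrite -(prednK p_gt0) big_nat_recr// [RHS]big_nat_recl//= addrC; congr (_ + _).
  by rewrite -iterS (prednK p_gt0) theta_p.
have [g cg gE] := free_descend (fun z _ => cF z) (fun z _ => Ft z).
exists g; split => //; rewrite !gE// => Fxy.
have Fy : F y = 0.
  rewrite /F big_nat_cond big1// => k; rewrite andbT => /andP[_ kp].
  by apply: (nbhs_singleton (uW _ _)) => /(_ (Ordinal kp)).
have : 0 < F x.
  rewrite /F -(prednK p_gt0) big_nat_recl//= ltr_pwDl//.
  by apply: sumr_ge0.
by rewrite Fxy Fy ltxx.
Qed.

(* [e] is a proper map from X to ]0, 1]. *)
Lemma proper_gauge (d : M -> R) :
  continuous d -> (forall x, 0 < d x <-> M0 x) -> (forall x, d (theta x) = d x) ->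
  exists e : X -> R, [/\ continuous e, forall y, 0 < e y <= 1,
    forall r, 0 < r -> compact [set y | r <= e y] &
    forall x, M0 x -> e (free_proj x) = Num.min (d x) 1].
Proof.
move=> cd dM0 dt; pose d1 x := Num.min (d x) 1.
have cd1 : continuous d1.
  move=> x; suff : {for x, continuous ((d : M -> R^o) \min cst 1)} by [].
  by apply: continuous_min; [exact: cd|exact: cst_continuous].
have d1t x : d1 (theta x) = d1 x by rewrite /d1 dt.
have [e ce eE] := free_descend (fun z _ => cd1 z) (fun z _ => d1t z).
exists e; split => //.
  move=> y; have [x Mx <-] := free_proj_surj y; rewrite eE//.
  by rewrite /d1 lt_min ltr01 ge_min lexx orbT !andbT; apply/dM0.
move=> r r0.
have -> : [set y | r <= e y] = free_proj @` [set x | r <= d1 x].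
  apply/seteqP; split => [y|_ [x /= rx <-]] /=.
    by have [x Mx <-] := free_proj_surj y; rewrite eE// => rx; exists x.
  rewrite eE//; apply/dM0; apply: lt_le_trans r0 (le_trans rx _).
  by rewrite /d1 ge_min lexx.
apply: continuous_compact.
  apply: continuous_in_subspaceT => x; rewrite inE/= => rx.
  apply: free_proj_continuous; apply/dM0; apply: lt_le_trans r0 (le_trans rx _).
  by rewrite /d1 ge_min lexx.
apply: (@subclosed_compact _ _ [set: M]) => //.
by apply: (@preimage_closed _ _ d1 [set y | r <= y]); [move=> x _; exact: cd1|exact: closed_ge].
Qed.

End OrbitSpace.

(** * The Stone-Cech compactification and the corona *)

Lemma compact_set_type (T : topologicalType) (A : set T) :
  compact A -> compact [set: A].
Proof.
move=> cA F FF _; pose G := set_val @ F.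
have GF : ProperFilter G by exact: fmap_proper_filter.
have GA : G A.
  suff : F [set z : A | A (set_val z)] by [].
  by apply: filterS filterT => z _ /=; have := valP z; rewrite inE.
have [a [Aa aG]] := cA G GF GA.
exists (SigSub (mem_set Aa)); split => // U V FU [_ [[V' oV' <-] /= V'a V'V]].
have GU : G (set_val @` U).
  suff : F (set_val @^-1` (set_val @` U)) by [].
  by apply: filterS FU => z Uz; exists z.
have [_ [[z Uz <-] V'z]] := aG _ V' GU (open_nbhs_nbhs (conj oV' V'a)).
by exists z; split => //; exact: V'V.
Qed.

Lemma set_type_hausdorff (T : topologicalType) (A : set T) :
  hausdorff_space T -> hausdorff_space A.
Proof.
move=> hT x y xy; apply: val_inj; apply: hT => U V Ux Vy.
have [z [Uz Vz]] := xy _ _ (@set_val_continuous _ A x U Ux) (@set_val_continuous _ A y V Vy).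
by exists (set_val z).
Qed.

Lemma compact_positive_bound (R : realType) (T : topologicalType) (B : set T) (f : T -> R) :
  compact B -> continuous f -> (forall x, B x -> 0 < f x) ->
  exists2 e, 0 < e & forall x, B x -> e <= f x.
Proof.
move=> cB cf f0.
have [x Bx|s sP] := @compact_finite_cover _ B (fun x => [set y | 0 < f x /\ f x / 2 < f y]) cB.
  have fx := f0 x Bx; apply: filterI; first exact: filterS filterT.
  by apply: (cvgr_gt _ (cf x)); lra.
exists (\big[Num.min/1]_(x <- s | 0 < f x) (f x / 2)).
  elim/big_ind: _ => // [x y x0 y0|x fx]; first by rewrite lt_min x0.
  by rewrite divr_gt0.
move=> x Bx; have [y ys [fy /= xy]] := sP x Bx.
apply: le_trans (ltW xy).
elim: s ys {sP} => // z s IH; rewrite inE big_cons => /orP[/eqP <-|/IH le].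
  by rewrite fy ge_min lexx.
by case: ifP => // _; rewrite ge_min le orbT.
Qed.

Section Corona.
Variables (R : realType) (X : topologicalType).
Local Notation C := (Cplx R).
Local Notation T := (prod_topology (fun _ : unit_fun R X => R)).
Local Notation ev := (@stone_cech_eval R X).
Variable e : X -> R.
Hypotheses (ce : continuous e) (e01 : forall y, 0 < e y <= 1).
Hypothesis e_proper : forall r, 0 < r -> compact [set y | r <= e y].

Let coord_cont (f : unit_fun R X) : continuous (fun z : T => z f).
Proof. exact: (@proj_continuous {classic unit_fun R X} (fun=> R) f). Qed.

Lemma stone_cech_eval_continuous : continuous ev.
Proof.
move=> x; apply/cvg_sup => f U [/= _ [[V oV <-] /= Vx VU]].
have [cf _] := svalP f.
have : nbhs x (sval f @^-1` V) by apply: cf; exact: open_nbhs_nbhs.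
by apply: filterS => y Vy; apply: VU.
Qed.

(** Rescaled to [0, 1], [F] is one of the indices of the product, so the extension is the
    corresponding coordinate, scaled back. *)
Lemma real_stone_cech_extension (F : X -> R) :
  continuous F -> (forall x, `|F x| <= 1) ->
  exists G : T -> R, continuous G /\ forall x, G (ev x) = F x.
Proof.
move=> cF F1; pose u x := (1 + F x) / 2.
have uP : continuous u /\ range u `<=` `[0, 1].
  split.
    move=> x; apply: cvgM; last exact: cvg_cst.
    by apply: cvgD; [exact: cvg_cst|exact: cF].
  move=> _ [x _ <-]; rewrite /= in_itv/= /u.
  by have := F1 x; rewrite ler_norml => /andP[a b]; apply/andP; split; lra.
pose f : unit_fun R X := exist _ u uP.
exists (fun z => 2 * z f - 1); split.
  move=> z; apply: (@continuous_comp _ _ _ (fun z : T => z f) (fun r : R => 2 * r - 1)).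
    exact: coord_cont.
  apply: cvgB; last exact: cvg_cst.
  by apply: cvgM; [exact: cvg_cst|exact: cvg_id].
by move=> x; rewrite /stone_cech_eval /= /u; lra.
Qed.

Lemma stone_cech_extension (F : X -> C) :
  continuous F -> (forall x, modC (F x) <= 1) ->
  exists G : T -> C, continuous G /\ forall x, G (ev x) = F x.
Proof.
move=> cF F1.
have [||G1 [cG1 G1E]] := @real_stone_cech_extension (fun x => ReC (F x)).
- move=> x; apply: (@continuous_comp _ _ _ F (@ReC R)); first exact: cF.
  exact: ReC_cont.
- by move=> x; apply: le_trans (F1 x); rewrite -toC_le modCE; exact: normc_ge_Re.
have [||G2 [cG2 G2E]] := @real_stone_cech_extension (fun x => ImC (F x)).
- move=> x; apply: (@continuous_comp _ _ _ F (@ImC R)); first exact: cF.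
  exact: ImC_cont.
- by move=> x; apply: le_trans (F1 x); rewrite -toC_le modCE; exact: normc_ge_Im.
exists (fun z => toC (G1 z) + 'i%C * toC (G2 z)); split; first exact: complex_continuous.
by move=> x; rewrite G1E G2E -complexRI.
Qed.

Lemma stone_cech_identity (Z : topologicalType) (F G : T -> Z) z :
  hausdorff_space Z -> continuous F -> continuous G ->
  (forall x, F (ev x) = G (ev x)) -> @stone_cech R X z -> F z = G z.
Proof.
move=> hZ cF cG FG zX; apply: hZ => U V Uz Vz.
have nU : nbhs z (F @^-1` U) := cF z U Uz.
have nV : nbhs z (G @^-1` V) := cG z V Vz.
have [_ [[x _ <-] [Ux Vx]]] := zX _ (filterI nU nV).
by exists (F (ev x)); split => //; rewrite FG.
Qed.

Lemma prod_hausdorff : hausdorff_space T.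
Proof.
apply: (@separated_hausdorff R) => x y xy; apply: contrapT => H; apply: xy.
apply/funext => f; apply: contrapT => xyf; apply: H.
by exists (fun z : T => z f); split => //; exact: coord_cont.
Qed.

Lemma stone_cech_compact : compact (@stone_cech R X).
Proof.
have cub : compact [set z : T | forall f, `[0, 1]%classic (z f)].
  apply: (@tychonoff {classic unit_fun R X} (fun=> R) (fun=> `[0, 1]%classic)) => _.
  exact: segment_compact.
apply: (subclosed_compact _ cub); first exact: closed_closure.
have clcub := compact_closed prod_hausdorff cub.
rewrite [X in _ `<=` X](closure_id _).1//; apply: closureS.
by move=> _ [x _ <-] f /=; have [_ f01] := svalP f; apply: f01; exists x.
Qed.

(** If [G z > 0], then [z] is in the closure of the image of [[set y | G z / 2 <= e y]]. As [e] is
    proper this image is compact, hence closed, and [z] comes from X. The corona is thus the zero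
    set of [G] in beta(X), in particular closed. *)
Lemma stone_cech_gauge : exists G : T -> R,
  [/\ continuous G, forall x, G (ev x) = e x &
    forall z, @stone_cech R X z -> 0 <= G z /\
      ((@stone_cech R X `\` range ev) z <-> G z = 0)].
Proof.
have [|G [cG GE]] := @real_stone_cech_extension e ce.
  by move=> x; have /andP[a b] := e01 x; rewrite ger0_norm// ltW.
exists G; split => // z zX.
have G0 : 0 <= G z.
  have : closed [set z | 0 <= G z].
    by apply: (@preimage_closed _ _ G [set y | 0 <= y]); [move=> ? _; exact: cG|exact: closed_ge].
  move=> /closure_id G0; suff : [set z | 0 <= G z] z by [].
  rewrite G0; apply: closureS zX => _ [x _ <-] /=.
  by rewrite GE ltW//; have /andP[] := e01 x.
split => //; split; last first.
  move=> Gz; split => // -[x _ xz]; have /andP[] := e01 x.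
  by rewrite -GE xz Gz ltxx.
move=> [_ nz]; apply: contrapT => Gz0; apply: nz.
have Gz : 0 < G z by rewrite lt_neqAle G0 andbT eq_sym; apply/eqP.
have cK : compact (ev @` [set y | G z / 2 <= e y]).
  apply: continuous_compact; last by apply: e_proper; lra.
  exact: continuous_subspaceT stone_cech_eval_continuous.
have clK := compact_closed prod_hausdorff cK.
suff : (ev @` [set y | G z / 2 <= e y]) z by move=> [x _ <-]; exists x.
move/closure_id : clK => ->.
move=> U Uz.
have Gz' : nbhs z [set y | G z / 2 < G y] by apply: (cvgr_gt _ (cG z)); lra.
have [_ [[x _ <-] [Ux /= Gx]]] := zX _ (filterI Uz Gz').
exists (ev x); split => //; exists x => //=.
by rewrite -GE ltW.
Qed.

End Corona.

Lemma tietze_set_type (R : realType) (T : topologicalType) (K A : set T) (f : A -> R) :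
  compact K -> hausdorff_space T -> closed A ->
  continuous f -> (forall a, `|f a| <= 1) ->
  exists g : K -> R, continuous g /\
    forall (a : A) (k : K), set_val a = set_val k -> g k = f a.
Proof.
move=> cK hT clA cf f1.
have nK : normal_space K.
  by apply: compact_normal; [exact: set_type_hausdorff|exact: compact_set_type].
pose A' : set K := [set k | A (set_val k)].
have clA' : closed A'.
  by apply: (@preimage_closed _ _ (set_val : K -> T) A) => // x _; exact: set_val_continuous.
pose F (k : K) : R := if pselect (A (set_val k)) is left h then f (SigSub (mem_set h)) else 0.
have FE (a : A) (k : K) : set_val a = set_val k -> F k = f a.
  move=> ak; rewrite /F; case: pselect => [h|nh]; last first.
    by exfalso; apply: nh; rewrite -ak; have := valP a; rewrite inE.
  by congr f; apply: val_inj; rewrite /= -ak.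
have [||g [gF cg _]] := @continuous_bounded_extension _ R nK A' clA' F 1 ltr01.
- apply/subspace_sigL_continuousP.
  have hA (a : A') : set_val (set_val a) \in A.
    by have := valP a; rewrite !inE.
  pose conv (a : A') : A := SigSub (hA a).
  rewrite (_ : sigL A' F = f \o conv); last first.
    by apply/funext => a; rewrite /sigL/=; apply: FE.
  move=> a; apply: continuous_comp; last exact: cf.
  apply: initial_continuous_at.
  apply: (@continuous_comp _ _ _ (set_val : A' -> K) (set_val : K -> T));
    exact: set_val_continuous.
- by move=> k _; rewrite /F; case: pselect => [h|_]; rewrite ?f1// normr0.
exists g; split => // a k ak; rewrite -(FE _ _ ak); apply/esym/gF.
by rewrite inE /A'/= -ak; have := valP a; rewrite inE.
Qed.

Lemma rank_one_le1 (R : realType) (I : finType) (P : I -> I -> Cplx R) :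
  rank_one_projection P -> forall i j, modC (P i j) <= 1.
Proof.
move=> [PJ PP P0 P1] i j.
have Pii k : P k k = toC (ReC (P k k)) by apply: ge0_toC.
have Pge0 k : 0 <= ReC (P k k) by rewrite -toC_le -Pii.
have Ple1 k : ReC (P k k) <= 1.
  have : \sum_k ReC (P k k) = 1.
    apply: toC_inj; rewrite -[RHS]P1 /toC rmorph_sum/=; apply: eq_bigr => l _.
    by rewrite [RHS]Pii.
  by move=> <-; rewrite (bigD1 k)//= lerDl sumr_ge0.
have : modC (P i j) ^+ 2 = ReC (P i i) * ReC (P j j).
  by apply: toC_inj; rewrite -mul_conjE -PJ PP toCM -!Pii.
move=> e; rewrite -(@ler_pXn2r _ 2%N)// ?nnegrE ?modC_ge0// expr1n e.
by rewrite mulr_ile1.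
Qed.

Lemma rank_one_vector (R : realType) (I : finType) (v : I -> Cplx R) :
  \sum_i v i * (v i)^* = 1 -> rank_one_projection (fun i j => v i * (v j)^*).
Proof.
move=> v1; split => //.
- by move=> i j; rewrite rmorphM/= conjCK mulrC.
- by move=> i j k l; ring.
- by move=> i; exact: mul_conjC_ge0.
Qed.

(** The sum is the squared modulus of the scalar product of [s] and [v], written in the entries of
    [v v^*]. Replacing these by those of [s s^*] turns it into |s|^4, and |s|^2 = |v|^2 = 1 by
    comparing traces. *)
Lemma rank_one_pairing (R : realType) (I : finType) (s v : I -> Cplx R) :
  (forall i j, v i * (v j)^* = s i * (s j)^*) -> \sum_i v i * (v i)^* = 1 ->
  \sum_i \sum_j (s i)^* * s j * (v i * (v j)^*) = 1.
Proof.
move=> vs v1.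
have s1 : \sum_i s i * (s i)^* = 1 by rewrite -v1; apply: eq_bigr => i _; rewrite vs.
rewrite (eq_bigr (fun i => s i * (s i)^* )) ?s1// => i _.
rewrite (eq_bigr (fun j => s i * (s i)^* * (s j * (s j)^* ))).
  by rewrite -mulr_sumr s1 mulr1.
by move=> j _; rewrite vs; ring.
Qed.

Lemma pairing_norm (R : realType) (I : finType) (s v : I -> Cplx R) :
  (\sum_i (s i)^* * v i) * (\sum_i (s i)^* * v i)^* =
  \sum_i \sum_j (s i)^* * s j * (v i * (v j)^*).
Proof.
rewrite rmorph_sum mulr_suml; apply: eq_bigr => i _.
rewrite mulr_sumr; apply: eq_bigr => j _.
by rewrite rmorphM/= conjCK; ring.
Qed.

(** * From a trivialization over the corona to an approximate one near infinity *)

Section CoronaTrivialization.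
Variables (R : realType) (X : topologicalType).
Local Notation C := (Cplx R).
Local Notation T := (prod_topology (fun _ : unit_fun R X => R)).
Local Notation ev := (@stone_cech_eval R X).
Local Notation bX := (@stone_cech R X).
Variable e : X -> R.
Hypotheses (ce : continuous e) (e01 : forall y, 0 < e y <= 1).
Hypothesis e_proper : forall r, 0 < r -> compact [set y | r <= e y].
Hypothesis H2 : trivial_group (cech_cohomology (corona R X) 2).
Variables (I : finType) (P : I -> I -> X -> C).
Hypotheses (cP : forall i j, continuous (P i j)).
Hypothesis P1 : forall x, rank_one_projection (fun i j => P i j x).

Let hC : hausdorff_space C. Proof. exact: norm_hausdorff. Qed.

(** The algebraic identities pass from X to beta(X) by density. Positivity follows from them:
    multiplying [Q_ii] by the trace gives the sum over [j] of |Q_ij|^2. *)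
Lemma stone_cech_rank_one : exists Q : I -> I -> T -> C,
  [/\ forall i j, continuous (Q i j), forall i j x, Q i j (ev x) = P i j x &
    forall z, bX z -> rank_one_projection (fun i j => Q i j z)].
Proof.
have /boolp.choice[Q QP] : forall ij : I * I, exists G : T -> C, continuous G /\
    forall x, G (ev x) = P ij.1 ij.2 x.
  move=> ij; apply: stone_cech_extension; first exact: cP.
  by move=> x; exact: (rank_one_le1 (P1 x)).
have cQ i j : continuous (Q (i, j)) by have [] := QP (i, j).
have QE i j x : Q (i, j) (ev x) = P i j x by have [_] := QP (i, j); exact.
exists (fun i j => Q (i, j)); split => // z zX.
have QJ i j : Q (j, i) z = (Q (i, j) z)^*.
  apply: (@stone_cech_identity _ _ _ (Q (j, i)) (fun z => (Q (i, j) z)^*)) => //.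
    exact: conj_continuous.
  by move=> x; rewrite !QE; have [] := P1 x.
have QQ i j k l : Q (i, j) z * Q (k, l) z = Q (i, l) z * Q (k, j) z.
  apply: (@stone_cech_identity _ _ _ (fun z => Q (i, j) z * Q (k, l) z)
    (fun z => Q (i, l) z * Q (k, j) z)) => //.
  - exact: mulC_continuous.
  - exact: mulC_continuous.
  - by move=> x; rewrite !QE; have [] := P1 x.
have Qtr : \sum_i Q (i, i) z = 1.
  apply: (@stone_cech_identity _ _ _ (fun z => \sum_i Q (i, i) z) (fun=> 1)) => //.
  - by move=> y; apply: sum_continuous => i; exact: cQ.
  - exact: (@cst_continuous T C 1).
  - by move=> x; under eq_bigr do rewrite QE; have [] := P1 x.
split => // i; rewrite -[X in 0 <= X]mulr1 -Qtr mulr_sumr sumr_ge0// => j _.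
by rewrite QQ (QJ i j) mul_conjC_ge0.
Qed.

(** The trivializing vector is extended from the corona to beta(X) by Tietze, coordinate by
    coordinate. Its pairing [q] with the projection is 1 on the corona, so [q <= 1/2] defines a
    compact set where the gauge [G] is positive, hence bounded below by some [r]. *)
Lemma corona_trivialization : exists t : I -> X -> C,
  (forall i, continuous (t i)) /\
  exists2 r, 0 < r & forall x, e x < r ->
    1 / 2 < ReC (\sum_i \sum_j (t i x)^* * t j x * P i j x).
Proof.
have [Q [cQ QE Q1]] := stone_cech_rank_one.
have [G [cG GE GP]] := stone_cech_gauge ce e01 e_proper.
have hT := @prod_hausdorff R X; have cbX := @stone_cech_compact R X.
pose A := bX `\` range ev.
have clA : closed A.
  rewrite (_ : A = bX `&` [set z | G z = 0]).
    apply: closedI; first exact: closed_closure.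
    apply: (@preimage_closed _ _ G [set 0]); first by move=> z _; exact: cG.
    exact: closed_eq.
  apply/seteqP; split => z /=.
    by move=> Az; have [zX _] := Az; have [_ <-] := GP z zX.
  by move=> [zX]; have [_ <-] := GP z zX.
have cA : compact A by apply: (subclosed_compact clA cbX) => z [].
have [||||s [cs sP]] := @rank_one_factorization R I (corona R X)
    (fun i j (y : corona R X) => Q i j (set_val y)) _ _ H2.
- exact: compact_set_type.
- exact: set_type_hausdorff.
- move=> i j y; apply: (@continuous_comp _ _ _ (set_val : corona R X -> T) (Q i j)).
    exact: set_val_continuous.
  exact: cQ.
- by move=> y; apply: Q1; have := valP y; rewrite inE => -[].
have s1 i y : modC (s i y) <= 1.
  have yX : bX (set_val y) by have := valP y; rewrite inE => -[].
  have := rank_one_le1 (Q1 _ yX) i i.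
  by rewrite sP mul_conjE -[modC _]/(ReC _) norm_toC ReCK ger0_norm ?sqr_ge0// expr_le1// modC_ge0.
have /boolp.choice[S SP] : forall i, exists g : bX -> C, continuous g /\
    forall (a : corona R X) (k : bX), set_val a = set_val k -> g k = s i a.
  move=> i.
  have [||g1 [cg1 g1E]] := @tietze_set_type R T bX A (fun a => ReC (s i a)) cbX hT clA.
  - by move=> y; apply: (@continuous_comp _ _ _ (s i) (@ReC R)); [exact: cs|exact: ReC_cont].
  - by move=> y; apply: le_trans (s1 i y); rewrite -toC_le modCE; exact: normc_ge_Re.
  have [||g2 [cg2 g2E]] := @tietze_set_type R T bX A (fun a => ImC (s i a)) cbX hT clA.
  - by move=> y; apply: (@continuous_comp _ _ _ (s i) (@ImC R)); [exact: cs|exact: ImC_cont].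
  - by move=> y; apply: le_trans (s1 i y); rewrite -toC_le modCE; exact: normc_ge_Im.
  exists (fun k => toC (g1 k) + 'i%C * toC (g2 k)); split; first exact: complex_continuous.
  by move=> a k ak; rewrite (g1E _ _ ak) (g2E _ _ ak) -complexRI.
have cS i : continuous (S i) by have [] := SP i.
pose q (k : bX) := ReC (\sum_i \sum_j (S i k)^* * S j k * Q i j (set_val k)).
have cq : continuous q.
  move=> k; apply: (@continuous_comp _ _ _ (fun k : bX => \sum_i \sum_j (S i k)^* * S j k * Q i j (set_val k)) (@ReC R));
    last exact: ReC_cont.
  apply: sum_continuous => i; apply: sum_continuous => j.
  apply: (@mulC_continuous R bX (fun k => (S i k)^* * S j k) (fun k => Q i j (set_val k))).
    by apply: mulC_continuous; [exact: conj_continuous|exact: cS].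
  move=> k'; apply: (@continuous_comp _ _ _ (set_val : bX -> T) (Q i j)).
    exact: set_val_continuous.
  exact: cQ.
have [|||r r0 rP] := @compact_positive_bound R bX [set k | q k <= 1 / 2] (G \o set_val).
- apply: (@subclosed_compact _ _ [set: bX]) => //; last exact: compact_set_type.
  by apply: (@preimage_closed _ _ q [set y | y <= 1 / 2]); [move=> x _; exact: cq|exact: closed_le].
- by move=> k; apply: continuous_comp; [exact: set_val_continuous|exact: cG].
- move=> k /= qk; have kX : bX (set_val k) by have := valP k; rewrite inE.
  have [G0 GA] := GP _ kX; rewrite lt_neqAle G0 andbT eq_sym; apply/eqP => /GA Ak.
  pose a : corona R X := SigSub (mem_set Ak).
  have SE i : S i k = s i a by have [_ h] := SP i; exact: h.
  have : q k = 1.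
    rewrite /q -[1]/(ReC (toC 1)); congr ReC.
    have QS i j : Q i j (set_val k) = s i a * (s j a)^* by rewrite -sP.
    under eq_bigr do under eq_bigr do rewrite !SE QS.
    apply: (@rank_one_pairing _ _ (s^~ a) (s^~ a)) => //.
    have [_ _ _ <-] := Q1 _ kX; by apply: eq_bigr => i _; rewrite QS.
  by move=> q1; move: qk; rewrite q1; lra.
have mem x : ev x \in bX by rewrite inE; apply: subset_closure; exists x.
pose kev x : bX := SigSub (mem x).
have ckev : continuous kev.
  by move=> x; apply: initial_continuous_at; exact: stone_cech_eval_continuous.
exists (fun i x => S i (kev x)); split.
  by move=> i x; apply: continuous_comp; [exact: ckev|exact: cS].
exists r => // x xr.
have : ~ q (kev x) <= 1 / 2.
  by move=> /rP /=; rewrite GE leNgt xr.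
move=> /negP; rewrite -ltNge /q.
by under eq_bigr do under eq_bigr do rewrite QE.
Qed.

End CoronaTrivialization.

(** * Triviality of the line bundle *)

(** [P] is constantly [c] off the compact set [[set y | r <= e y]], so the value [c] at infinity
    extends it continuously. Properness of [e] also makes X locally compact, as the Hausdorff
    property of X^+ requires. *)
Lemma one_point_factorization (R : realType) (X : topologicalType) (e : X -> R)
    (J : finType) (P : J -> J -> X -> Cplx R) (c : J -> J -> Cplx R) (r : R) :
  hausdorff_space X -> continuous e -> (forall x, 0 < e x) ->
  (forall r, 0 < r -> compact [set x | r <= e x]) ->
  trivial_group (cech_cohomology_lc 2 X) ->
  (forall i j, continuous (P i j)) ->
  (forall x, rank_one_projection (fun i j => P i j x)) -> rank_one_projection c ->
  0 < r -> (forall x, e x < r -> forall i j, P i j x = c i j) ->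
  exists s : J -> X -> Cplx R, (forall i, continuous (s i)) /\
    (forall i j x, P i j x = s i x * (s j x)^*).
Proof.
move=> hX ce e0 ecpt H2 cP P1 c1 r0 Pc.
have e_closed q : closed [set x | q <= e x].
  by apply: (@preimage_closed _ _ e [set y | q <= y]); [move=> x _; exact: ce|exact: closed_ge].
have lcX : locally_compact [set: X].
  move=> x _; exists [set y | e x / 2 <= e y].
    rewrite withinET; have := e0 x => ex.
    have : nbhs x [set y | e x / 2 < e y] by apply: (cvgr_gt _ (ce x)); lra.
    by apply: filterS => y /= /ltW.
  by split => //; apply: ecpt; have := e0 x; lra.
pose Q i j (o : one_point_compactification X) : Cplx R :=
  if o is Some x then P i j x else c i j.
have cQ i j : continuous (Q i j).
  move=> [x|] U QU; first exact: (cP i j x U QU).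
  exists [set y | r <= e y]; first by split; [exact: ecpt|exact: e_closed].
  move=> _ [[y /= /negP yr <-]|->]; last exact: nbhs_singleton QU.
  by rewrite /preimage/= Pc ?ltNge//; exact: (nbhs_singleton QU).
have [||||s [cs sP]] := @rank_one_factorization R J (one_point_compactification X) Q _ _ H2.
- exact: one_point_compactification_compact.
- exact: one_point_compactification_hausdorff.
- exact: cQ.
- by move=> [x|]; [exact: P1|exact: c1].
exists (fun i x => s i (Some x)); split; last by move=> i j x; rewrite -sP.
move=> i x; apply: (@continuous_comp _ _ _ (Some : X -> one_point_compactification X) (s i)).
  exact: one_point_compactification_some_continuous.
exact: cs.
Qed.

Lemma continuous_at_sum (R : numFieldType) (X : topologicalType) (I : Type) (r : seq I)
    (f g : I -> X -> R) (x : X) :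
  (forall i, {for x, continuous (f i)}) -> (forall i, {for x, continuous (g i)}) ->
  {for x, continuous (fun y => \sum_(i <- r) f i y * g i y)}.
Proof. by move=> cf cg; apply: sum_continuous => i; apply: cvgM; [exact: cf|exact: cg]. Qed.

Section UnitFunction.
Variables (R : realType) (M : topologicalType) (theta : M -> M) (p : nat).
Hypotheses (cM : compact [set: M]) (hM : hausdorff_space M).
Hypothesis scM : @second_countable M.
Hypotheses (p_prime : prime p) (theta_cont : continuous theta).
Hypothesis theta_p : iter p theta = id.
Local Notation C := (Cplx R).
Local Notation M0 := (~` fixed_points theta).
Local Notation X := (free_orbit_space theta).
Variables (w : C).
Hypotheses (w_p : w ^+ p = 1) (w_unit : w * w^* = 1).
Hypothesis dimM : covering_dim_le M 2.
Hypothesis M0_neq0 : M0 !=set0.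
Hypothesis H2_free : trivial_group (cech_cohomology_lc 2 X).
Hypothesis H2_corona : trivial_group (cech_cohomology (corona R X) 2).

Lemma free_unit_function : exists g : M -> C,
  [/\ forall x, M0 x -> {for x, continuous g},
      forall x, M0 x -> g (theta x) = w * g x &
      forall x, M0 x -> g x * (g x)^* = 1].
Proof.
have w1 := unit_modC w_unit.
have hX : hausdorff_space X by exact: (@free_orbit_hausdorff R M theta p).
have [d [cd d0 dM0 dt]] := @invariant_gauge R M theta p cM hM scM p_prime theta_cont theta_p.
have [I [H [cH eH H1]]] := finite_type_free cM hM scM p_prime theta_cont theta_p
  w_p w_unit dimM cd dM0 dt.
pose pr := free_proj M0_neq0.
have prt x : M0 x -> pr (theta x) = pr x by exact: free_proj_theta p_prime theta_p _ _.
have cpr x : M0 x -> {for x, continuous pr} by exact: free_proj_continuous.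
have [e [ce e01 ecpt eE]] := proper_gauge cM hM p_prime theta_cont theta_p M0_neq0 cd dM0 dt.
have pr_surj y : exists2 x, M0 x & pr x = y by exact: free_proj_surj.
have comp_pr (Z : topologicalType) (f : X -> Z) x : continuous f -> M0 x ->
    {for x, continuous (f \o pr)}.
  by move=> cf Mx; apply: continuous_comp; [exact: cpr|exact: cf].
have cjc x (f : M -> C) : {for x, continuous f} -> {for x, continuous (fun y => (f y)^*)}.
  by move=> cf; apply: (@continuous_comp _ _ _ f); [exact: cf|exact: conjC_cont].
have gram (K : finType) (v : K -> M -> C) :
    (forall i x, M0 x -> {for x, continuous (v i)}) ->
    (forall i x, M0 x -> v i (theta x) = w * v i x) ->
    exists Q : K -> K -> X -> C, (forall i j, continuous (Q i j)) /\
      (forall i j x, M0 x -> Q i j (pr x) = v i x * (v j x)^*).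
  move=> cv ev.
  have /boolp.choice[Q QP] : forall ij : K * K, exists q : X -> C, continuous q /\
      forall x, M0 x -> q (pr x) = v ij.1 x * (v ij.2 x)^*.
    move=> [i j] /=.
    have [||q cq qE] := @free_descend M theta p hM p_prime theta_cont theta_p M0_neq0 C
      (fun x => v i x * (v j x)^*).
    - by move=> x Mx; apply: cvgM; [exact: cv|apply: cjc; exact: cv].
    - move=> x Mx; rewrite !ev// rmorphM/=.
      rewrite [LHS](_ : _ = (w * w^*) * (v i x * (v j x)^*)); last by ring.
      by rewrite w_unit mul1r.
    by exists q.
  exists (fun i j => Q (i, j)); split => [i j|i j x Mx].
    by have [] := QP (i, j).
  by have [_ ->] := QP (i, j).
have pairing (K : finType) (v : K -> M -> C) (s : K -> X -> C) :
    (forall i x, M0 x -> {for x, continuous (v i)}) ->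
    (forall i x, M0 x -> v i (theta x) = w * v i x) ->
    (forall i, continuous (s i)) ->
    let g x := \sum_i (s i (pr x))^* * v i x in
    (forall x, M0 x -> {for x, continuous g}) /\ (forall x, M0 x -> g (theta x) = w * g x).
  move=> cv ev cs g; split => x Mx.
    apply: continuous_at_sum => i; last exact: cv.
    by apply: cjc; exact: comp_pr.
  rewrite /g mulr_sumr; apply: eq_bigr => i _; rewrite prt// ev//.
  by rewrite mulrCA.
have [P [cP PE]] := gram I H cH (fun i x _ => eH i x).
have P1 y : rank_one_projection (fun i j => P i j y).
  have [x Mx <-] := pr_surj y.
  have -> : (fun i j => P i j (pr x)) = (fun i j => H i x * (H j x)^*).
    by apply/funext => i; apply/funext => j; rewrite PE.
  by apply: rank_one_vector; exact: H1.
have [t [ct [r r0 tr]]] := corona_trivialization ce e01 ecpt H2_corona cP P1.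
pose g1 x := \sum_i (t i (pr x))^* * H i x.
have [cg1 eg1] : (forall x, M0 x -> {for x, continuous g1}) /\
    (forall x, M0 x -> g1 (theta x) = w * g1 x) by exact: pairing cH (fun i x _ => eH i x) ct.
(* 1/2 is the level of [modC (g1 x) ^+ 2] at which the cut-off below, [4 * modC (g1 x) ^+ 2 - 1],
   reaches 1. *)
have g1_large x : M0 x -> e (pr x) < r -> 1 / 2 < modC (g1 x) ^+ 2.
  move=> Mx /tr; rewrite -[X in _ -> _ < X]ReCK -mul_conjE /g1 pairing_norm.
  by under eq_bigr do under eq_bigr do rewrite PE//.
(* [a] is 1 near infinity on X, where [v] reduces to [g1], and [a <> 1] where [g1]
   vanishes. *)
pose a x : R := Num.min 1 (Num.max 0 (4 * modC (g1 x) ^+ 2 - 1)).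
have a_theta x : M0 x -> a (theta x) = a x.
  by move=> Mx; rewrite /a eg1// modCM w1 mul1r.
have a_cont x : M0 x -> {for x, continuous (fun y => toC (a y))}.
  move=> Mx; apply: (@continuous_comp _ _ _ a (@toC R)); last exact: toC_cont.
  apply: (@continuous_comp _ _ _ (fun y => modC (g1 y))
    (fun m : R => Num.min 1 (Num.max 0 (4 * m ^+ 2 - 1)) : R)).
    by apply: (@continuous_comp _ _ _ g1 (@modC R)); [exact: cg1|exact: modC_cont].
  set m0 := modC _.
  suff : {for m0, continuous ((cst 1 : R -> R^o) \min ((cst 0 : R -> R^o) \max
      (fun m : R => 4 * m ^+ 2 - 1 : R^o)))} by [].
  apply: continuous_min; first exact: cst_continuous.
  apply: continuous_max; first exact: cst_continuous.
  apply: cvgB; last exact: cvg_cst.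
  by apply: cvgM; [exact: cvg_cst|exact: exprn_continuous].
(* The coordinate [None] carries [g1]. Near infinity it is the only nonzero one, so the normalized
   vector has the constant projection [delta] there, although its phase need not converge. *)
pose v (j : option I) x : C :=
  if j is Some i then (1 - toC (a x)) * H i x else toC (a x) * g1 x.
have cv j x : M0 x -> {for x, continuous (v j)}.
  move=> Mx; case: j => [i|]; apply: cvgM.
  - by apply: cvgB; [exact: cvg_cst|exact: a_cont].
  - exact: cH.
  - exact: a_cont.
  - exact: cg1.
have ev j x : M0 x -> v j (theta x) = w * v j x.
  by move=> Mx; case: j => [i|]; rewrite /v a_theta// ?eH ?eg1// mulrCA.
have v_neq0 x : M0 x -> exists j, v j x != 0.
  move=> Mx; have [a1|a1] := eqVneq (a x) 1.
    exists None; rewrite /v a1 toC1 mul1r -modC_gt0.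
    rewrite lt_neqAle modC_ge0 andbT eq_sym; apply/eqP => m0.
    by move: a1; rewrite /a m0; case: (lerP 0) => _; case: lerP; lra.
  have [i Hi] : exists i, H i x != 0.
    apply: contrapT => nH; have := H1 x Mx; rewrite big1 => [/esym/eqP|i _].
      by rewrite oner_eq0.
    apply/eqP; rewrite mulf_eq0; apply/orP; left; apply: contrapT => /negP Hi.
    by apply: nH; exists i.
  exists (Some i); rewrite /v mulf_neq0// -toC1 -[X in X - _]/(toC 1) -toCN -toCD toC_eq0.
  by rewrite subr_eq0 eq_sym.
pose u j x := normalized (v^~ x) j.
have cu j x : M0 x -> {for x, continuous (u j)}.
  by move=> Mx; apply: normalized_continuous; [exact: v_neq0|move=> k; exact: cv].
have eu j x : M0 x -> u j (theta x) = w * u j x.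
  move=> Mx; rewrite /u -normalized_scale//; congr (normalized _ _).
  by apply/funext => k; exact: ev.
have u1 x : M0 x -> \sum_j u j x * (u j x)^* = 1.
  by move=> Mx; apply: normalized_sum; exact: v_neq0.
have [Q [cQ QE]] := gram _ u cu eu.
have Q1 y : rank_one_projection (fun i j => Q i j y).
  have [x Mx <-] := pr_surj y.
  have -> : (fun i j => Q i j (pr x)) = (fun i j => u i x * (u j x)^*).
    by apply/funext => i; apply/funext => j; rewrite QE.
  by apply: rank_one_vector; exact: u1.
pose delta (j : option I) : C := (j == None)%:R.
have delta1 : rank_one_projection (fun i j => delta i * (delta j)^*).
  apply: rank_one_vector; rewrite (bigD1 None)//= big1 /delta ?eqxx ?rmorph1 ?mulr1 ?addr0//.
  by move=> j /negPf ->; rewrite mul0r.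
have e0 y : 0 < e y by have /andP[] := e01 y.
have [y yr i j|s [cs sE]] := one_point_factorization hX ce e0 ecpt H2_free cQ Q1 delta1 r0.
  have [x Mx xy] := pr_surj y; rewrite -xy in yr *.
  have a1 : a x = 1.
    by have := g1_large x Mx yr; rewrite /a => h; rewrite min_l// le_max; apply/orP; right; lra.
  have uS k : u (Some k) x = 0 by rewrite /u /normalized /v a1 toC1 subrr !mul0r.
  have uN : u None x * (u None x)^* = 1.
    have := u1 x Mx; rewrite (bigD1 None)//= big1 ?addr0//.
    by move=> [k|//] _; rewrite uS mul0r.
  rewrite QE// /delta; case: i j => [i|] [j|]/=; rewrite ?uS ?mul0r ?rmorph0 ?mulr0//.
  by rewrite uN -[RHS]/(1 * 1^*) conjC1 mulr1.
have [cg eg] := pairing _ u s cu eu cs.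
exists (fun x => \sum_i (s i (pr x))^* * u i x); split => // x Mx.
rewrite pairing_norm; apply: rank_one_pairing; last exact: u1.
by move=> i j; rewrite -QE// sE.
Qed.

End UnitFunction.

(** * The crossed product *)

Section ContFunEval.
Variables (R : realType) (X : topologicalType).
Local Notation C := (Cplx R).

Lemma contfun_sum (I : Type) (r : seq I) (F : I -> contfun R X) x :
  (\sum_(i <- r) F i) x = \sum_(i <- r) F i x.
Proof. by elim/big_rec2: _ => // i y1 y2 _ <-. Qed.
Lemma contfun_eq (f g : contfun R X) : f =1 g -> f = g.
Proof. by move=> fg; apply: val_inj; apply/funext. Qed.

Lemma mx_contfunD n (A B : 'M[contfun R X]_n) i j x : (A + B) i j x = A i j x + B i j x.
Proof. by rewrite mxE. Qed.
Lemma mx_contfunZ n (k : C) (A : 'M[contfun R X]_n) i j x : mx_scale k A i j x = k * A i j x.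
Proof. by rewrite mxE. Qed.
Lemma mx_contfunM n (A B : 'M[contfun R X]_n) i j x :
  (A *m B) i j x = \sum_k A i k x * B k j x.
Proof. by rewrite mxE contfun_sum. Qed.
Lemma mx_contfun_star n (A : 'M[contfun R X]_n) i j x : mx_star A i j x = (A j i x)^*.
Proof. by rewrite !mxE. Qed.
End ContFunEval.

(** At a zero of [h] the factor [u] may jump, since |u h| = |h| tends to 0. This is what lets [g] be
    discontinuous at the fixed points. *)
Lemma unimodular_twist (R : realType) (M : topologicalType) (u h : M -> Cplx R) (x : M) :
  (forall y, u y * (u y)^* = 1) -> {for x, continuous h} ->
  ({for x, continuous u} \/ h x = 0) -> {for x, continuous (fun y => u y * h y)}.
Proof.
move=> u1 ch [cu|hx]; first by apply: cvgM; [exact: cu|exact: ch].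
have nu y : `|u y| = 1.
  by apply/eqP; rewrite -sqrp_eq1// normCK u1.
rewrite /prop_for /continuous_at hx mulr0.
apply/cvgrPdist_lt => e e0; have /cvgrPdist_lt/(_ e e0) := ch.
by apply: filterS => y; rewrite hx !sub0r !normrN normrM nu mul1r.
Qed.

(** * The crossed product as matrix fields along orbits *)

Section CrossedProduct.
Variables (R : realType) (M : topologicalType) (theta : M -> M) (q : nat).
Local Notation p := q.+2.
Local Notation C := (Cplx R).
Local Notation M0 := (~` fixed_points theta).
Local Notation piM := (orbit_proj theta).
Hypotheses (p_prime : prime p) (theta_cont : continuous theta).
Hypothesis theta_p : iter p theta = id.
Variables (w : C) (g : M -> C).
Hypotheses (w_p : w ^+ p = 1) (w_unit : w * w^* = 1).
Hypothesis w_prim : forall i j : 'I_p, (w ^+ i)^* * w ^+ j = 1 -> i = j.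
Hypotheses (g_unit : forall x, g x * (g x)^* = 1).
Hypothesis g_cont : forall x, M0 x -> {for x, continuous g}.
Hypothesis g_theta : forall x, M0 x -> g (theta x) = w * g x.

Let iterp k x : iter (k %% p) theta x = iter k theta x.
Proof. exact: iter_modp. Qed.

Lemma orbit_invariant (T : Type) (f : M -> T) x y :
  (forall x, f (theta x) = f x) -> piM x = piM y -> f x = f y.
Proof.
move=> ft /(orbit_projP p_prime theta_p)[k ->].
by elim: k => // k IH; rewrite iterS ft.
Qed.

(** A matrix field compatible with the shift is determined by row 0 along the orbit; so an element
    of the crossed product can be rebuilt from such a field. *)
Lemma shift_iter (T : Type) (F : M -> 'I_p -> 'I_p -> T) :
  (forall x (l m : 'I_p), F (theta x) l m = F x (1 + l) (1 + m)) ->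
  forall x (l m : 'I_p), F (iter l theta x) 0 (m - l) = F x l m.
Proof.
move=> Ft x l m.
have FI k a b : F (iter k theta x) a b = F x (iter k (+%R 1) a) (iter k (+%R 1) b).
  by elim: k a b => // k IH a b; rewrite iterS Ft IH -!iterSr.
have l1 : (1 : 'I_p) *+ l = l by rewrite Zp_nat valZpK.
by rewrite FI !iter_addr l1 addr0 addrC subrK.
Qed.

Definition adjoint (A : 'M[C]_p) : 'M[C]_p := \matrix_(i, j) (A j i)^*.

Lemma adjointM A B : adjoint (A *m B) = adjoint B *m adjoint A.
Proof.
apply/matrixP => i j; rewrite !mxE rmorph_sum; apply: eq_bigr => k _.
by rewrite !mxE rmorphM/= mulrC.
Qed.

Lemma adjointK A : adjoint (adjoint A) = A.
Proof. by apply/matrixP => i j; rewrite !mxE conjCK. Qed.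

(* The regular representation of the crossed product over the orbit of x. *)
Definition orbit_matrix (a : crossed_product R p M) (x : M) : 'M[C]_p :=
  \matrix_(l, m) a (m - l) (iter l theta x).

(* The columns of [frame x] diagonalize the cyclic shift. *)
Definition frame (x : M) : 'M[C]_p :=
  \matrix_(m, j) (toC (Num.sqrt p%:R)^-1 * w ^+ (j * m) * g x ^+ j).

(** Its (i, j) entry is the [g^-(i-j) h_ij] of the overview. *)
Definition orbit_symbol (a : crossed_product R p M) (x : M) : 'M[C]_p :=
  adjoint (frame x) *m orbit_matrix a x *m frame x.

Lemma orbit_matrixM a b x :
  orbit_matrix (crossed_mul theta_cont a b) x = orbit_matrix a x *m orbit_matrix b x.
Proof.
apply/matrixP => l m; rewrite !mxE /crossed_mul contfun_sum.
rewrite [RHS](reindex_inj (addIr l))/=; apply: eq_bigr => i _.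
rewrite -[LHS]/(a i (iter l theta x) * b (m - l - i) (iter i theta (iter l theta x))).
rewrite !mxE addrK; congr (_ * _).
rewrite /= -iterD iterp; congr (contfun_val (b _) _).
by rewrite (addrC i) opprD addrA.
Qed.

Lemma orbit_matrix_star a x :
  orbit_matrix (crossed_star theta_cont a) x = adjoint (orbit_matrix a x).
Proof.
apply/matrixP => l m; rewrite !mxE /crossed_star /=.
rewrite opprB -iterD -iterp; congr ((contfun_val (a _) (iter _ theta x))^*).
exact: (congr1 (@nat_of_ord p) (subrK l m)).
Qed.

Let wexp_p k : w ^+ (k * p) = 1.
Proof. by rewrite mulnC exprM w_p expr1n. Qed.

Let wexp_mod k : w ^+ (k %% p) = w ^+ k.
Proof. by rewrite [in RHS](divn_eq k p) exprD wexp_p mul1r. Qed.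

Let conjX (z : C) k : z * z^* = 1 -> (z ^+ k)^* * z ^+ k = 1.
Proof. by move=> z1; rewrite rmorphXn/= -exprMn mulrC z1 expr1n. Qed.

(** Orthogonality of characters: [z] is a p-th root of unity, and by [w_prim] it differs from 1 when
    [i != j], so its powers sum to 0. *)
Lemma frame_unitary x : adjoint (frame x) *m frame x = 1%:M.
Proof.
apply/matrixP => i j; rewrite !mxE.
pose z := (w ^+ i)^* * w ^+ j.
have p0 : (p%:R : R) != 0 by rewrite pnatr_eq0.
have cc : toC (Num.sqrt (p%:R : R))^-1 * toC (Num.sqrt (p%:R : R))^-1 = toC (p%:R)^-1.
  by rewrite -toCM -invfM -expr2 sqr_sqrtr.
rewrite (eq_bigr (fun m : 'I_p => toC (p%:R)^-1 * ((g x ^+ i)^* * g x ^+ j) * z ^+ m)); last first.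
  move=> m _; rewrite !mxE !rmorphM/= conj_toC -cc /z exprMn -rmorphXn/= -!exprM.
  by ring.
rewrite -mulr_sumr; have [ij|ij] := eqVneq i j.
  have zz : z = 1 by rewrite /z ij conjX.
  rewrite ij.
  rewrite (conjX _ (g_unit x)) mulr1 (eq_bigr (fun=> 1)); last by move=> m _; rewrite zz expr1n.
  rewrite sumr_const card_ord mulr1n -[X in _ * X](_ : toC p%:R = _); last first.
    by rewrite /toC rmorph_nat.
  by rewrite -toCM mulVf.
have z1 : z != 1 by apply: contraNneq ij => /w_prim ->.
have zp : z ^+ p = 1.
  by rewrite /z exprMn -rmorphXn/= -!exprM !wexp_p rmorph1 mulr1.
have : (z - 1) * \sum_(m < p) z ^+ m = 0 by rewrite -subrX1 zp subrr.
move=> /eqP; rewrite mulf_eq0 subr_eq0 (negPf z1)/= => /eqP ->.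
by rewrite mulr0.
Qed.

Lemma frame_unitary_r x : frame x *m adjoint (frame x) = 1%:M.
Proof. exact: mulmx1C (frame_unitary x). Qed.

(** The factor [w ^+ j] that [g x ^+ j] gains along [theta] is the one by which consecutive rows
    differ; [w ^+ p = 1] takes care of the wrap-around. *)
Lemma frame_shift x (m j : 'I_p) : M0 x -> frame (theta x) m j = frame x (1 + m) j.
Proof.
move=> Mx; rewrite !mxE g_theta// exprMn mulrA; congr (_ * _).
rewrite -!mulrA -exprD; congr (_ * _).
rewrite -[RHS]wexp_mod /= modnMmr wexp_mod; congr (w ^+ _).
by rewrite (modn_small (isT : (1 < p)%N)) add1n mulnS addnC.
Qed.

Lemma frame_fixed x (m j : 'I_p) : frame x (1 + m) j = w ^+ j * frame x m j.
Proof.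
rewrite !mxE -[in LHS]wexp_mod /= modnMmr wexp_mod.
rewrite (modn_small (isT : (1 < p)%N)) add1n mulnS exprD.
by ring.
Qed.

Lemma orbit_matrix_shift a x (l m : 'I_p) :
  orbit_matrix a (theta x) l m = orbit_matrix a x (1 + l) (1 + m).
Proof.
rewrite !mxE /= iterp (modn_small (isT : (1 < p)%N)) add1n iterSr.
by rewrite opprD addrACA subrr add0r.
Qed.

Let symbolE a x i j : orbit_symbol a x i j =
  \sum_l \sum_m (frame x l i)^* * orbit_matrix a x l m * frame x m j.
Proof.
rewrite /orbit_symbol mxE exchange_big/=; apply: eq_bigr => m _.
by rewrite mxE mulr_suml; apply: eq_bigr => l _; rewrite mxE.
Qed.

Let symbol_shiftE a x i j : orbit_symbol a x i j =
  \sum_(l : 'I_p) \sum_(m : 'I_p) (frame x (1 + l) i)^* * orbit_matrix a x (1 + l) (1 + m) * frame x (1 + m) j.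
Proof.
rewrite symbolE (reindex_inj (addrI (1 : 'I_p)))/=; apply: eq_bigr => l _.
by rewrite (reindex_inj (addrI (1 : 'I_p))).
Qed.

Lemma orbit_symbol_theta a x : orbit_symbol a (theta x) = orbit_symbol a x.
Proof.
have [xx|Mx] := pselect (fixed_points theta x); first by rewrite xx.
apply/matrixP => i j; rewrite symbolE symbol_shiftE.
apply: eq_bigr => l _; apply: eq_bigr => m _.
by rewrite !frame_shift// orbit_matrix_shift.
Qed.

(** At a fixed point the orbit matrix is circulant, and the columns of the frame are eigenvectors of
    the cyclic shift with distinct eigenvalues. Shifting both indices multiplies the (i, j) entry by
    [w^(j-i)], which is not 1. *)
Lemma orbit_symbol_diagonal a x i j :
  fixed_points theta x -> i != j -> orbit_symbol a x i j = 0.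
Proof.
move=> xx ij.
have : orbit_symbol a x i j = ((w ^+ i)^* * w ^+ j) * orbit_symbol a x i j.
  rewrite [LHS]symbol_shiftE symbolE mulr_sumr; apply: eq_bigr => l _.
  rewrite mulr_sumr; apply: eq_bigr => m _.
  rewrite -orbit_matrix_shift xx !frame_fixed rmorphM/=.
  by ring.
move=> /eqP; rewrite -subr_eq0 -[X in X - _]mul1r -mulrBl mulf_eq0 subr_eq0 eq_sym.
by case/orP => /eqP // /w_prim e; rewrite e eqxx in ij.
Qed.

Lemma twist_continuous (i j : 'I_p) (h : M -> C) : continuous h ->
  (forall x, fixed_points theta x -> i != j -> h x = 0) ->
  continuous (fun y => (g y ^+ i)^* * g y ^+ j * h y).
Proof.
move=> ch h0 x; apply: (@unimodular_twist R M (fun y => (g y ^+ i)^* * g y ^+ j) h x); [|exact: ch|].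
  move=> y; rewrite rmorphM/= conjCK mulrACA conjX// mul1r.
  by rewrite mulrC conjX.
have [<-|ij] := eqVneq i j.
  left; rewrite (_ : (fun _ => _) = cst 1); first exact: cst_continuous.
  by apply/funext => y; rewrite conjX.
have [xx|Mx] := pselect (fixed_points theta x); first by right; exact: h0.
have cgk k : {for x, continuous (fun y => g y ^+ k)}.
  elim: k => [|k IH]; first exact: cst_continuous.
  rewrite (_ : (fun _ => _) = (fun y => g y * g y ^+ k)); last first.
    by apply/funext => y; rewrite exprS.
  by apply: cvgM; [exact: g_cont|exact: IH].
left; apply: cvgM; last exact: cgk.
by apply: (@continuous_comp _ _ _ (fun y => g y ^+ i)); [exact: cgk|exact: conjC_cont].
Qed.

Lemma orbit_symbol_continuous a i j : continuous (fun x => orbit_symbol a x i j).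
Proof.
pose c : C := toC (Num.sqrt p%:R)^-1.
pose h x := \sum_(l : 'I_p) \sum_(m : 'I_p)
  (c * w ^+ (i * l))^* * orbit_matrix a x l m * (c * w ^+ (j * m)).
have hE x : orbit_symbol a x i j = (g x ^+ i)^* * g x ^+ j * h x.
  rewrite symbolE mulr_sumr; apply: eq_bigr => l _; rewrite mulr_sumr; apply: eq_bigr => m _.
  by rewrite !mxE !rmorphM/= -/c; ring.
rewrite (_ : (fun x => _) = (fun x => (g x ^+ i)^* * g x ^+ j * h x)); last exact/funext.
apply: twist_continuous.
  move=> x; apply: sum_continuous => l; apply: sum_continuous => m.
  apply: cvgM; last exact: cvg_cst.
  apply: cvgM; first exact: cvg_cst.
  suff : {for x, continuous (fun y => orbit_matrix a y l m)} by [].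
  rewrite (_ : (fun x => _) = a (m - l) \o iter l theta); last first.
    by apply/funext => y; rewrite mxE.
  apply: (@continuous_comp _ _ _ (iter l theta) (a (m - l))).
    exact: iter_continuous.
  exact: contfun_continuous.
move=> x xx ij; have := orbit_symbol_diagonal a xx ij; rewrite hE => /eqP.
rewrite mulf_eq0 => /orP[|/eqP//].
rewrite mulf_eq0 conjC_eq0 !expf_eq0 => gx.
have : g x != 0 by apply: contra_eq_neq (g_unit x) => ->; rewrite mul0r eq_sym oner_eq0.
by move=> /negPf g0; move: gx; rewrite g0 !andbF.
Qed.

Lemma orbit_symbol_contfun a i j : exists f : contfun R (orbit_space theta),
  forall x, f (piM x) = orbit_symbol a x i j.
Proof.
have inv x y : piM x = piM y -> orbit_symbol a x i j = orbit_symbol a y i j.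
  by apply: (@orbit_invariant C (fun x => orbit_symbol a x i j)) => z; rewrite orbit_symbol_theta.
have cf : (fun y : orbit_space theta => orbit_symbol a (repr y) i j) \in @contfun_pred R (orbit_space theta).
  apply/asboolP.
  apply: (@repr_comp_continuous M _ C (fun x => orbit_symbol a x i j)).
    exact: orbit_symbol_continuous.
  by move=> x y /eqP /inv ->.
exists (ContFun cf) => x /=; apply: inv.
exact: reprK.
Qed.

Definition crossed_iso (a : crossed_product R p M) : 'M[contfun R (orbit_space theta)]_p :=
  \matrix_(i, j) projT1 (cid (orbit_symbol_contfun a i j)).

Lemma crossed_isoE a i j x : crossed_iso a i j (piM x) = orbit_symbol a x i j.
Proof. by rewrite mxE; case: cid. Qed.

Lemma matrix_contfun_eq (A B : 'M[contfun R (orbit_space theta)]_p) :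
  (forall i j x, A i j (piM x) = B i j (piM x)) -> A = B.
Proof.
move=> AB; apply/matrixP => i j; apply: contfun_eq => y.
by have [x <-] := orbit_proj_surj y.
Qed.

Lemma orbit_matrix_inj a b : (forall x, orbit_matrix a x = orbit_matrix b x) -> a = b.
Proof.
move=> ab; apply/funext => k; apply: contfun_eq => x.
by have /matrixP/(_ 0 k) := ab x; rewrite !mxE subr0.
Qed.

Lemma orbit_matrix_symbol a x :
  frame x *m orbit_symbol a x *m adjoint (frame x) = orbit_matrix a x.
Proof.
by rewrite !mulmxA frame_unitary_r mul1mx -mulmxA frame_unitary_r mulmx1.
Qed.

Lemma orbit_symbolD a b x :
  orbit_symbol (a + b) x = orbit_symbol a x + orbit_symbol b x.
Proof.
rewrite /orbit_symbol -mulmxDl -mulmxDr; congr (_ *m _ *m _).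
by apply/matrixP => l m; rewrite !mxE.
Qed.

Lemma orbit_symbolZ k a x : orbit_symbol (k *: a) x = k *: orbit_symbol a x.
Proof.
rewrite /orbit_symbol scalemxAl scalemxAr; congr (_ *m _ *m _).
by apply/matrixP => l m; rewrite !mxE.
Qed.

Lemma orbit_symbolM a b x :
  orbit_symbol (crossed_mul theta_cont a b) x = orbit_symbol a x *m orbit_symbol b x.
Proof.
rewrite /orbit_symbol orbit_matrixM; have := frame_unitary_r x.
move: (orbit_matrix a x) (orbit_matrix b x) (frame x) => A B U UU.
by rewrite !mulmxA -[X in _ = X *m _ *m _]mulmxA UU mulmx1.
Qed.

Lemma orbit_symbol_star a x :
  orbit_symbol (crossed_star theta_cont a) x = adjoint (orbit_symbol a x).
Proof. by rewrite /orbit_symbol orbit_matrix_star !adjointM adjointK mulmxA. Qed.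

Lemma crossed_iso_inj : injective crossed_iso.
Proof.
move=> a b ab; apply: orbit_matrix_inj => x.
rewrite -(orbit_matrix_symbol a) -(orbit_matrix_symbol b).
suff -> : orbit_symbol a x = orbit_symbol b x by [].
by apply/matrixP => i j; rewrite -!crossed_isoE ab.
Qed.

Section Surjective.
Variable A : 'M[contfun R (orbit_space theta)]_p.
Hypothesis A_diag : diagonal_on (fixed_orbits theta) A.

Let Ax (x : M) : 'M[C]_p := \matrix_(i, j) A i j (piM x).

(** The candidate orbit matrix of a preimage of [A]; its row 0 will provide the coefficients. *)
Let Fhat (x : M) : 'M[C]_p := frame x *m Ax x *m adjoint (frame x).

Let FhatE x l m : Fhat x l m = \sum_i \sum_j frame x l i * A i j (piM x) * (frame x m j)^*.
Proof.
rewrite /Fhat mxE exchange_big/=; apply: eq_bigr => j _.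
by rewrite mxE mulr_suml; apply: eq_bigr => i _; rewrite !mxE.
Qed.

(** On M_0 this is [frame_shift]. At a fixed point the shift costs [w^(i-j)] in the (i, j) term,
    harmless because [A] is diagonal there. *)
Let Fhat_shift x (l m : 'I_p) : Fhat (theta x) l m = Fhat x (1 + l) (1 + m).
Proof.
rewrite !FhatE; apply: eq_bigr => i _; apply: eq_bigr => j _.
have [xx|Mx] := pselect (fixed_points theta x); last first.
  by rewrite !frame_shift// (orbit_proj_theta p_prime theta_p).
rewrite xx !frame_fixed rmorphM/=.
have [<-|ij] := eqVneq i j.
  rewrite [RHS](_ : _ = ((w ^+ i)^* * w ^+ i) * (frame x l i * A i i (piM x) * (frame x m i)^*)).
    by rewrite conjX// mul1r.
  by ring.
by rewrite (A_diag _ ij) ?mulr0 ?mul0r//; exists x.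
Qed.

Let coef_cont k : (fun x => Fhat x 0 k) \in @contfun_pred R M.
Proof.
apply/asboolP.
pose c : C := toC (Num.sqrt p%:R)^-1.
rewrite (_ : (fun x => _) = (fun x => \sum_(j : 'I_p) \sum_(i : 'I_p) (c * (c * w ^+ (j * k))^*) *
   ((g x ^+ j)^* * g x ^+ i * A i j (piM x)))); last first.
  apply/funext => x; rewrite FhatE exchange_big/=; apply: eq_bigr => j _; apply: eq_bigr => i _.
  by rewrite !mxE muln0 expr0 !rmorphM/= -/c; ring.
move=> x; apply: sum_continuous => j; apply: sum_continuous => i.
apply: cvgM; first exact: cvg_cst.
apply: (@twist_continuous j i (fun x => A i j (piM x))).
  move=> y; apply: continuous_comp; first exact: orbit_proj_continuous.
  exact: contfun_continuous.
by move=> y yy ij; apply: A_diag; [exists y|rewrite eq_sym].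
Qed.

Lemma crossed_iso_surj : exists a, crossed_iso a = A.
Proof.
pose a : crossed_product R p M := fun k => ContFun (coef_cont k).
exists a; apply: matrix_contfun_eq => i j x; rewrite crossed_isoE.
suff aF : orbit_matrix a x = Fhat x.
  rewrite /orbit_symbol aF /Fhat !mulmxA frame_unitary mul1mx -mulmxA frame_unitary mulmx1.
  by rewrite mxE.
apply/matrixP => l m; rewrite mxE.
exact: (@shift_iter C (fun x => Fhat x) Fhat_shift x l m).
Qed.

End Surjective.

Lemma crossed_iso_range : range crossed_iso =
  @diagonal_on R p (orbit_space theta) (fixed_orbits theta).
Proof.
apply/seteqP; split => [_ [a _ <-]|A /crossed_iso_surj[a <-]]; last by exists a.
move=> _ [x xx <-] i j ij; rewrite crossed_isoE.
exact: orbit_symbol_diagonal.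
Qed.

Lemma crossed_product_isomorphism : star_isomorphic_to_matrices theta_cont
  (@diagonal_on R p (orbit_space theta) (fixed_orbits theta)).
Proof.
exists crossed_iso; split.
- move=> a b; apply: matrix_contfun_eq => i j x.
  rewrite [LHS]crossed_isoE [RHS]mx_contfunD orbit_symbolD mxE.
  by congr (_ + _); rewrite crossed_isoE.
- move=> k a; apply: matrix_contfun_eq => i j x.
  rewrite [LHS]crossed_isoE [RHS]mx_contfunZ orbit_symbolZ mxE.
  by congr (_ * _); rewrite crossed_isoE.
- move=> a b; apply: matrix_contfun_eq => i j x.
  rewrite (mx_contfunM (crossed_iso a)) (crossed_isoE (crossed_mul theta_cont a b)) orbit_symbolM mxE.
  by apply: eq_bigr => k _; rewrite (crossed_isoE a) (crossed_isoE b).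
- move=> a; apply: matrix_contfun_eq => i j x.
  rewrite (mx_contfun_star (crossed_iso a)) (crossed_isoE (crossed_star theta_cont a)) (crossed_isoE a).
  by rewrite orbit_symbol_star mxE.
by split; [exact: crossed_iso_inj|exact: crossed_iso_range].
Qed.

End CrossedProduct.

Theorem theorem3p4 (R : realType) (p : nat) (p_prime : prime p)
    (M : topologicalType) (M_sch : separable_compact_hausdorff M)
    (theta : M -> M) (theta_homeo : homeomorphism theta)
    (theta_period : has_period p theta)
    (fixed_nonempty : fixed_points theta !=set0)
    (dim_le2 : covering_dim_le M 2)
    (H2_free : trivial_group (cech_cohomology_lc 2 (free_orbit_space theta)))
    (free_dense : dense (~` fixed_points theta))
    (H2_corona :
      trivial_group (cech_cohomology (corona R (free_orbit_space theta)) 2)) :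
  star_isomorphic_to_matrices (proj1 theta_homeo)
    (@diagonal_on R p (orbit_space theta) (fixed_orbits theta)).
Proof.
have [cM hM scM] := M_sch; have [theta_p theta_id] := theta_period.
(* With [p] of the form [q.+2], ['Z_p] and ['I_p] agree by computation, so matrix indices can be
   added modulo [p]. *)
case: p => [|[|q]] // in p_prime theta_p theta_period *.
pose w : Cplx R := turn (q.+2%:R^-1).
have turnX t k : turn t ^+ k = turn (k%:R * t) :> Cplx R.
  elim: k => [|k IH]; first by rewrite expr0 mul0r turn0.
  by rewrite exprS IH -turnD -[k.+1%:R]nat1r mulrDl mul1r.
have q0 : (q.+2%:R : R) != 0 by rewrite pnatr_eq0.
have w_p : w ^+ q.+2 = 1 by rewrite turnX divff// (turn_int R 1).
have w_unit : w * w^* = 1 by exact: turn_mul_conj.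
have w_prim (i j : 'I_q.+2) : (w ^+ i)^* * w ^+ j = 1 -> i = j.
  rewrite !turnX turn_conj -turnD => /turn_eq1[n].
  rewrite addrC -mulrBl => e.
  have : (j%:R - i%:R : R) = (n * q.+2%:Z)%:~R.
    by rewrite intrM -e divfK.
  have -> : (j%:R - i%:R : R) = (j%:Z - i%:Z)%:~R by rewrite rmorphB.
  move=> /intr_inj ij.
  have : (q.+2 %| j%:Z - i%:Z)%Z by apply/dvdzP; exists n.
  rewrite -eqz_mod_dvd !modz_nat !modn_small// => /eqP[] ji.
  exact/esym/val_inj.
have M0_neq0 : ~` fixed_points theta !=set0.
  apply: contrapT => H; apply: theta_id; apply/funext => x.
  by apply: contrapT => tx; apply: H; exists x.
have [g0 [cg0 eg0 ug0]] := free_unit_function cM hM scM p_prime (proj1 theta_homeo) theta_p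
  w_p w_unit dim_le2 M0_neq0 H2_free H2_corona.
(* The default 1 at fixed points keeps [g] unimodular everywhere, so that [frame] is unitary there
   too; no continuity is claimed at these points. *)
pose g x := if pselect (fixed_points theta x) then 1 else g0 x.
have gE x : (~` fixed_points theta) x -> g x = g0 x.
  by rewrite /g; case: pselect.
have oM0 := free_open hM (proj1 theta_homeo).
have g_unit x : g x * (g x)^* = 1.
  by rewrite /g; case: pselect => [xx|/ug0//] /=; rewrite mul1r rmorph1.
have g_cont x : (~` fixed_points theta) x -> {for x, continuous g}.
  move=> Mx; apply: (@continuous_near_eq _ _ _ g0); last exact: cg0.
  have : nbhs x (~` fixed_points theta) by exact: open_nbhs_nbhs.
  by apply: filterS => y; exact: gE.
have g_theta x : (~` fixed_points theta) x -> g (theta x) = w * g x.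
  by move=> Mx; rewrite !gE ?eg0//; exact: (free_theta p_prime theta_p).
exact: (crossed_product_isomorphism p_prime (proj1 theta_homeo) theta_p
  w_p w_unit w_prim g_unit g_cont g_theta).
Qed.
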